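(* Let $r\ge1$, $h:=1/(r+1)$, $\alpha_0,\ldots,\alpha_r\in\mathbb{C}\setminus\{0\}$, $\beta_0,\ldots,\beta_r\in\mathbb{C}$, and $$\alpha=\sum_{j=0}^r\alpha_j\mathbf{1}_{(jh,(j+1)h]},\qquad\beta=\sum_{j=0}^r\beta_j\mathbf{1}_{(jh,(j+1)h]}.$$ If $\mathfrak{m}(\alpha^{-1})\neq0$, then the following conditions are equivalent: (i) $D_\alpha+\beta$ is continuously invertible in $L_2(0,1)$; (ii) $D_\alpha+\beta$ is one-to-one; (iii) $\begin{pmatrix}a_{00}^{(r)}&\alpha_r^{-1}a_{01}^{(r)}\end{pmatrix}\tilde A_{\alpha_{r-1}}\cdots\tilde A_{\alpha_1}\begin{pmatrix}a_{01}^{(0)}\\ \alpha_0a_{11}^{(0)}\end{pmatrix}\neq0$, where $\tilde A_{\alpha_j}=\begin{pmatrix}1&0\\0&\alpha_j\end{pmatrix}A^{(j)}\begin{pmatrix}1&0\\0&\alpha_j^{-1}\end{pmatrix}$ for $j\in\{1,\ldots,r-1\}$ and $A^{(j)}=(a_{kl}^{(j)})_{k,l\in\{0,1\}}$ is the transition matrix with respect to $\bigl(\tfrac1{r+1},\tfrac{\beta_j}{\alpha_j}\bigr)$, $j\in\{0,\ldots,r\}$.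
   Context: $\mathfrak{m}(\gamma):=\int_0^1\gamma$. $D_\alpha$ is the operator in $L_2(0,1)$ with domain $\{u\in H_0^1(0,1);\ (\alpha u')'\in L_2(0,1)\}$ and $D_\alpha u=-(\alpha u')'$ (distributional sense); $D_\alpha+\beta$ has the same domain and acts as $u\mapsto-(\alpha u')'+\beta u$. For $h>0$ and $\tau\in\mathbb{C}$, the transition matrix with respect to $(h,\tau)$ is the (unique) matrix $A\in\mathbb{C}^{2\times2}$ such that for all $v\in\mathbb{C}^2$ and $u$ the solution of $u''=\tau u$ on $(0,h)$ with $(u(0),u'(0))^\top=v$ one has $Av=(u(h),u'(h))^\top$. For $r=1$ the product $\tilde A_{\alpha_{r-1}}\cdots\tilde A_{\alpha_1}$ is the identity matrix. ''Continuously invertible'' means bijective with bounded inverse. *)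

(* Defs.v *)
From HB Require Import structures.
From mathcomp Require Import all_boot all_order all_algebra.
From mathcomp Require Import all_classical all_reals all_analysis.
From mathcomp Require Import complex.
Import Order.TTheory GRing.Theory Num.Theory.
Import numFieldNormedType.Exports.

Set Implicit Arguments.
Unset Strict Implicit.
Unset Printing Implicit Defensive.

Local Open Scope classical_set_scope.
Local Open Scope ring_scope.
Local Open Scope complex_scope.

(* Complex-valued functions on (0,1) are total functions [R -> R[i]] of which
   only the values on `]0, 1[ matter.  R[i] carries no topology or measure
   theory over R, so derivatives, integrals and measurability are taken on real
   and imaginary parts. *)

Definition unit_itv {R : realType} : set R := `]0, 1[%classic.

Definition re_part {R : realType} (f : R -> R[i]) : R -> R :=
  fun x => complex.Re (f x).

Definition im_part {R : realType} (f : R -> R[i]) : R -> R :=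
  fun x => complex.Im (f x).

Definition cintegral {R : realType} (f : R -> R[i]) : R[i] :=
  (\int[lebesgue_measure]_(x in unit_itv) re_part f x)
  +i* (\int[lebesgue_measure]_(x in unit_itv) im_part f x).

(* The mean m(gamma), the integral of gamma over (0,1). *)
Definition mean {R : realType} (gamma : R -> R[i]) : R[i] := cintegral gamma.

Definition cderiv {R : realType} (f : R -> R[i]) : R -> R[i] :=
  fun x => derive1 (re_part f) x +i* derive1 (im_part f) x.

(* Elements of L_2(0,1) are represented by square integrable functions, with
   [ae_eq01] as equality. *)
Definition ae_eq01 {R : realType} (f g : R -> R[i]) : Prop :=
  ae_eq lebesgue_measure unit_itv f g.

Definition L2 {R : realType} (f : R -> R[i]) : Prop :=
  [/\ measurable_fun unit_itv (re_part f),
      measurable_fun unit_itv (im_part f) &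
      (\int[lebesgue_measure]_(x in unit_itv)
         ((ComplexField.Normc.normc (f x)) ^+ 2)%:E < +oo)%E].

Definition L2norm {R : realType} (f : R -> R[i]) : R :=
  Num.sqrt (\int[lebesgue_measure]_(x in unit_itv)
              (ComplexField.Normc.normc (f x)) ^+ 2).

Definition smooth {R : realType} (f : R -> R) : Prop :=
  forall (n : nat) (x : R), derivable (derive1n n f) x 1.

(* C_c^oo(0,1), with functions extended by zero to R. *)
Definition test_fun {R : realType} (phi : R -> R[i]) : Prop :=
  [/\ smooth (re_part phi), smooth (im_part phi) &
      exists K : set R, [/\ compact K, K `<=` unit_itv &
        forall x, ~ K x -> phi x = 0]].

Definition loc_integrable {R : realType} (f : R -> R[i]) : Prop :=
  locally_integrable unit_itv (re_part f) /\
  locally_integrable unit_itv (im_part f).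

(* g is the distributional derivative of f on (0,1). *)
Definition weak_deriv {R : realType} (f g : R -> R[i]) : Prop :=
  [/\ loc_integrable f, loc_integrable g &
      forall phi, test_fun phi ->
        cintegral (fun x => f x * cderiv phi x) =
        - cintegral (fun x => g x * phi x)].

(* u lies in H^1(0,1) and its weak derivative is du. *)
Definition H1 {R : realType} (u du : R -> R[i]) : Prop :=
  [/\ L2 u, L2 du & weak_deriv u du].

Definition H1norm {R : realType} (u du : R -> R[i]) : R :=
  Num.sqrt (L2norm u ^+ 2 + L2norm du ^+ 2).

(* H^1_0(0,1) is the closure of C_c^oo(0,1) in H^1(0,1); as in [H1], the second
   argument is the weak derivative. *)
Definition H10 {R : realType} (u du : R -> R[i]) : Prop :=
  H1 u du /\
  forall e : R, 0 < e -> exists2 phi, test_fun phi &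
    H1norm (fun x => u x - phi x) (fun x => du x - cderiv phi x) < e.

(* Operators in L_2(0,1) are given by their graph. *)
Definition L2_operator (R : realType) := (R -> R[i]) -> (R -> R[i]) -> Prop.

(* The graph of D_alpha: u in H^1_0, and f in L_2 with (alpha u')' = - f. *)
Definition D_op {R : realType} (alpha : R -> R[i]) : L2_operator R :=
  fun u f => exists2 du, H10 u du &
    L2 f /\ weak_deriv (fun x => alpha x * du x) (fun x => - f x).

(* The graph of D_alpha + beta. *)
Definition D_op_add {R : realType} (alpha beta : R -> R[i]) : L2_operator R :=
  fun u f => L2 f /\
    exists2 g, D_op alpha u g & ae_eq01 f (fun x => g x + beta x * u x).

Definition one_to_one {R : realType} (T : L2_operator R) : Prop :=
  forall u v f, T u f -> T v f -> ae_eq01 u v.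

Definition onto {R : realType} (T : L2_operator R) : Prop :=
  forall f, L2 f -> exists u, T u f.

(* Bijective with bounded inverse. *)
Definition continuously_invertible {R : realType} (T : L2_operator R) : Prop :=
  [/\ one_to_one T, onto T &
      exists C : R, forall u f, T u f -> L2norm u <= C * L2norm f].

Definition cis_derive {R : realType} (f : R -> R[i]) (x : R) (d : R[i]) : Prop :=
  is_derive x 1 (re_part f) (complex.Re d) /\
  is_derive x 1 (im_part f) (complex.Im d).

Definition ccontinuous_within {R : realType} (A : set R) (f : R -> R[i]) : Prop :=
  {within A, continuous (re_part f)} /\ {within A, continuous (im_part f)}.

(* u solves u'' = tau u on (0,h); du is u', and both are continuous up to the
   end points, where u and u' are evaluated. *)
Definition ode_solution {R : realType} (h : R) (tau : R[i])
    (u du : R -> R[i]) : Prop :=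
  [/\ ccontinuous_within `[0, h]%classic u,
      ccontinuous_within `[0, h]%classic du &
      forall x : R, 0 < x < h ->
        cis_derive u x (du x) /\ cis_derive du x (tau * u x)].

Definition col2 {R : realType} (a b : R[i]) : 'cV[R[i]]_2 :=
  \col_(i < 2) (if i == 0 then a else b).

Definition row2 {R : realType} (a b : R[i]) : 'rV[R[i]]_2 :=
  \row_(i < 2) (if i == 0 then a else b).

Definition is_transition_matrix {R : realType} (h : R) (tau : R[i])
    (A : 'M[R[i]]_2) : Prop :=
  forall (v : 'cV[R[i]]_2) (u du : R -> R[i]),
    ode_solution h tau u du -> col2 (u 0) (du 0) = v ->
    A *m v = col2 (u h) (du h).

(* The unique matrix satisfying [is_transition_matrix] (for h > 0). *)
Definition transition_matrix {R : realType} (h : R) (tau : R[i]) : 'M[R[i]]_2 :=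
  xget 0 [set A | is_transition_matrix h tau A].

(* The matrix A~ = diag(1, a) A diag(1, a^-1). *)
Definition tilde {R : realType} (a : R[i]) (A : 'M[R[i]]_2) : 'M[R[i]]_2 :=
  diag_mx (row2 1 a) *m A *m diag_mx (row2 1 a^-1).

(* The sum over 0 <= j <= r of c_j times the indicator of (jh, (j+1)h], where
   h = 1/(r+1). *)
Definition piecewise_const {R : realType} (r : nat) (c : nat -> R[i]) :
    R -> R[i] :=
  let h : R := r.+1%:R^-1 in
  fun x => \sum_(j < r.+1) c j * \1_(`]j%:R * h, j.+1%:R * h]%classic) x.

(* Main.v *)
Require Import Defs.
From mathcomp Require Import all_boot all_order all_algebra.
From mathcomp Require Import all_classical all_reals all_analysis.
From mathcomp Require Import measurable_realfun complex ring lra.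
Import Order.TTheory GRing.Theory Num.Theory.
Import numFieldNormedType.Exports.

Set Implicit Arguments.
Unset Strict Implicit.
Unset Printing Implicit Defensive.

Local Open Scope classical_set_scope.
Local Open Scope ring_scope.

(* Extend the bilinear form of D_alpha + beta from test functions to H^1_0 by
   density: if (D_alpha + beta) u = f and (D_alpha + beta) v = g, then
   int f v = int g u.  So surjectivity already gives injectivity, and any
   bounded right inverse is the inverse; no regularity theory for weak solutions
   is needed.

   In the variables (u, p) = (u, alpha u') the equation is a first order system
   with absolutely continuous solutions, whose homogeneous part is transported
   across the j-th cell by the matrix A~_j.  Let (u1, p1) be the homogeneous
   solution with u1(0) = 0 and p1(0) = alpha_0; the number in (iii) is u1(1).
   If u1(1) <> 0, variation of constants gives a bounded right inverse.  If
   u1(1) = 0, then u1 lies in the kernel; were it zero a.e., p1 would be the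
   constant alpha_0 and u1(1) = alpha_0 m(1/alpha) <> 0, a contradiction.

   That the functions built in this way lie in H^1_0 requires approximating
   u' = p / alpha in L_2 by test functions (smooth bumps exp(-1/Q) on the cells
   of a fine grid) whose means vanish, and then taking primitives. *)

(** * Integrals over open intervals and absolute continuity *)

Section IntervalIntegrals.
Context {R : realType}.
Notation mu := (@lebesgue_measure R).
Implicit Types (a b c x k M : R) (f g F G : R -> R).

(** The values of alpha may point in opposing directions of the complex plane, so the form int alpha
    u' v' need not be coercive, and it is bilinear rather than Hermitian. What survives is its
    symmetry without conjugation; the conjugate that turns a pairing into a norm is put into the
    right-hand side conj(u - v), which surjectivity allows.

    Absolute continuity is encoded as an integral identity with an integrable density. Nothing is
    then differentiated almost everywhere: the product rule becomes Fubini on a triangle, and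
    solutions on neighbouring cells are glued with no condition on the density at the common point,
    where alpha and beta may jump.

    The vanishing means come from the boundary values: the integral of u' is u(1) - u(0) = 0, so an
    L_2 approximation of u' has a small mean, which is removed by a multiple of one fixed test
    function of integral 1. The primitive of the corrected function is again a test function.

    Estimates are made on squares of real and imaginary parts, with crude factors 2, since only
    finiteness of the bounds matters. *)

Definition integrable_on a b f := mu.-integrable `]a, b[ (EFin \o f).

Lemma integrable_onS a b c d f : a <= c -> d <= b ->
  integrable_on a b f -> integrable_on c d f.
Proof.
move=> ac db; apply: integrableS => //.
by apply: subset_itv; rewrite bnd_simp.
Qed.

(** The end points form a null set. Open intervals match [unit_itv]; closed ones are what continuity
    of primitives and the fundamental theorem refer to. *)
Lemma integrable_on_closed a b f :
  integrable_on a b f <-> mu.-integrable `[a, b] (EFin \o f).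
Proof.
split=> [|]; last by apply: integrableS => //; apply: subset_itvScc; rewrite bnd_simp.
case: (ltP a b) => [ab|ba] fi; last first.
  move: ba; rewrite le_eqVlt => /predU1P[->|ba].
    rewrite set_itv1; apply: null_set_integrable => //.
      exact: measurable_fun_set1.
    exact: lebesgue_measure_set1.
  rewrite set_itv_ge ?bnd_simp -?ltNge//; exact: integrable_set0.
have mf : measurable_fun `[a, b] (EFin \o f).
  apply/emeasurable_fun_itv_obnd_cbndP/emeasurable_fun_itv_bndo_bndcP.
  exact: measurable_int fi.
have E : `[a, b]%classic `\` ([set a] `|` [set b]) = `]a, b[%classic.
  apply/seteqP; split=> x /=; rewrite !in_itv/=.
    move=> [/andP[ax xb] /not_orP[/eqP xa /eqP xb']].
    by rewrite !lt_neqAle ax xb eq_sym xa xb'.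
  by move=> /andP[ax xb]; rewrite !ltW//; split=> // -[] e; move: ax xb;
    rewrite e ltxx.
apply/(@negligible_integrable _ _ _ mu _ ([set a] `|` [set b])) => //.
- exact: measurableU.
- rewrite measureU0//; exact: lebesgue_measure_set1.
- by rewrite E.
Qed.

Lemma integral_on_closed a b f : integrable_on a b f ->
  \int[mu]_(x in `[a, b]) f x = \int[mu]_(x in `]a, b[) f x.
Proof.
move=> fi; rewrite -Rintegral_itv_obnd_cbnd.
  by rewrite Rintegral_itv_bndo_bndc.
apply: integrableS ((integrable_on_closed _ _ _).1 fi) => //.
by apply: subset_itvScc; rewrite bnd_simp.
Qed.

Lemma eq_integrable_on a b f g : (forall x, a < x < b -> f x = g x) ->
  integrable_on a b f -> integrable_on a b g.
Proof.
move=> fg; apply: eq_integrable => // x; rewrite inE/= in_itv/= => xab.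
by rewrite /= fg.
Qed.

Lemma eq_integral_on a b f g : (forall x, a < x < b -> f x = g x) ->
  \int[mu]_(x in `]a, b[) f x = \int[mu]_(x in `]a, b[) g x.
Proof.
move=> fg; apply: eq_Rintegral => x; rewrite inE/= in_itv/=; exact: fg.
Qed.

Lemma integrable_onD a b f g : integrable_on a b f -> integrable_on a b g ->
  integrable_on a b (fun x => f x + g x).
Proof. by move=> fi gi; apply: (integrableD _ fi gi). Qed.

Lemma integrable_onZ a b k f : integrable_on a b f ->
  integrable_on a b (fun x => k * f x).
Proof. by move=> fi; apply: (integrableZl _ k fi). Qed.

Lemma lebesgue_measure_oo_lty a b : (mu `]a, b[ < +oo)%E.
Proof.
by rewrite lebesgue_measure_itv/=; case: ifP => // _; rewrite -EFinB ltry.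
Qed.

Lemma integrable_on_cst a b k : integrable_on a b (cst k).
Proof.
apply: measurable_bounded_integrable => //; first exact: lebesgue_measure_oo_lty.
exact: bounded_cst.
Qed.

Lemma integral_on_cst a b k : a <= b ->
  \int[mu]_(x in `]a, b[) k = k * (b - a).
Proof.
move=> ab; rewrite Rintegral_cst//= lebesgue_measure_itv/= lte_fin.
by move: ab; rewrite le_eqVlt => /predU1P[->|->//]; rewrite ltxx subrr.
Qed.

Lemma integrable_onB a b f g : integrable_on a b f -> integrable_on a b g ->
  integrable_on a b (fun x => f x - g x).
Proof. by move=> fi gi; apply: (integrableB _ fi gi). Qed.

Lemma integrable_on_bounded a b f M : measurable_fun `]a, b[ f ->
  (forall x, a < x < b -> `|f x| <= M) -> integrable_on a b f.
Proof.
move=> mf fM; apply: measurable_bounded_integrable => //.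
  exact: lebesgue_measure_oo_lty.
exists M; split; first exact: num_real.
move=> y My x /=; rewrite in_itv/= => xab.
exact: (le_trans (fM _ xab) (ltW My)).
Qed.

Lemma integrable_onMb a b f g M : measurable_fun `]a, b[ f ->
  (forall x, a < x < b -> `|f x| <= M) -> integrable_on a b g ->
  integrable_on a b (fun x => f x * g x).
Proof.
move=> mf fM gi.
apply: (@integrableMr _ _ _ mu _ _ f (EFin \o g) mf) => //.
exists M; split; first exact: num_real.
move=> y My x /=; rewrite in_itv/= => xab.
exact: (le_trans (fM _ xab) (ltW My)).
Qed.

Lemma setU_oo a b c : a < b -> b < c ->
  `]a, c[%classic = `]a, b]%classic `|` `]b, c[%classic :> set R.
Proof. by move=> ab bc; rewrite -itv_bndbnd_setU// bnd_simp ltW. Qed.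

Lemma integrable_on_glue a b c f : integrable_on a b f -> integrable_on b c f ->
  integrable_on a c f.
Proof.
case: (leP b a) => [ba _|ab]; first exact: integrable_onS.
case: (leP c b) => [cb + _|bc f1 f2]; first exact: integrable_onS.
have f1' : mu.-integrable `]a, b] (EFin \o f).
  apply: integrableS ((integrable_on_closed _ _ _).1 f1) => //.
  by apply: subset_itvScc; rewrite bnd_simp.
rewrite /integrable_on (setU_oo ab bc).
have m1 := measurable_int _ f1'; have m2 := measurable_int _ f2.
apply/integrableP; split; first by apply/measurable_funU.
rewrite ge0_integral_setU//=.
- by apply: lte_add_pinfty; [case/integrableP: f1'|case/integrableP: f2].
- have : measurable_fun (`]a, b] `|` `]b, c[) (EFin \o f) by apply/measurable_funU.
  by move=> /measurable_EFinP ?; apply/measurable_EFinP; exact: measurableT_comp.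
- apply/disj_setPS => x /=; rewrite !in_itv/= => -[/andP[_ xb]] /andP[].
  by rewrite ltNge xb.
Qed.

Lemma integral_on_empty a b f : b <= a -> \int[mu]_(x in `]a, b[) f x = 0.
Proof. by move=> ba; rewrite set_itv_ge ?Rintegral_set0// bnd_simp -leNgt. Qed.

Lemma integral_on_split a b c f : a <= b -> b <= c -> integrable_on a c f ->
  \int[mu]_(x in `]a, c[) f x =
  \int[mu]_(x in `]a, b[) f x + \int[mu]_(x in `]b, c[) f x.
Proof.
move=> + + fi; rewrite le_eqVlt => /predU1P[->|ab].
  by rewrite (integral_on_empty _ (lexx b)) add0r.
rewrite le_eqVlt => /predU1P[<-|bc].
  by rewrite (integral_on_empty _ (lexx b)) addr0.
rewrite [in LHS](setU_oo ab bc) Rintegral_setU//.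
- congr (_ + _); rewrite -Rintegral_itv_bndo_bndc//.
  by apply: (@integrable_onS a c) => //; exact: ltW.
- by rewrite -(setU_oo ab bc).
- apply/disj_setPS => x /=; rewrite !in_itv/= => -[/andP[_ xb]] /andP[].
  by rewrite ltNge xb.
Qed.



(* F is absolutely continuous on [a, b], with derivative f. *)
Definition AC a b F f := integrable_on a b f /\
  forall x, a <= x <= b -> F x = F a + \int[mu]_(t in `]a, x[) f t.

Lemma AC_integrable a b F f : AC a b F f -> integrable_on a b f.
Proof. by case. Qed.

Lemma AC_incr a b F f x y : AC a b F f -> a <= x -> x <= y -> y <= b ->
  F y - F x = \int[mu]_(t in `]x, y[) f t.
Proof.
move=> [fi FE] ax xy yb.
rewrite (FE y) ?(le_trans ax)// (FE x) ?ax ?(le_trans xy)//.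
rewrite (integral_on_split ax xy); last exact: integrable_onS fi.
by ring.
Qed.

Lemma AC_S a b c d F f : a <= c -> d <= b -> AC a b F f -> AC c d F f.
Proof.
move=> ac db H; split; first exact: integrable_onS (AC_integrable H).
move=> x /andP[cx xd].
by rewrite -(AC_incr H ac cx) ?(le_trans xd)// addrC subrK.
Qed.

Lemma AC_glue a b c F f : AC a b F f -> AC b c F f -> a <= b -> AC a c F f.
Proof.
move=> H1 H2 ab.
have fi := integrable_on_glue (AC_integrable H1) (AC_integrable H2).
split=> // x /andP[ax xc]; case: (leP x b) => [xb|/ltW bx].
  by case: H1 => _; apply; rewrite ax.
rewrite (integral_on_split ab bx); last exact: integrable_onS fi.
rewrite -(AC_incr H1)// -(AC_incr H2)//; ring.
Qed.

(** The densities are compared on the open interval only, so a formula valid inside a cell may be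
    used although the coefficients can take other values at its left end point. *)
Lemma AC_eq a b F f G g : (forall x, a <= x <= b -> F x = G x) ->
  (forall x, a < x < b -> f x = g x) -> AC a b F f -> AC a b G g.
Proof.
move=> FG fg [fi FE]; split; first exact: eq_integrable_on fi.
move=> x /andP[ax xb]; rewrite -!FG ?ax ?lexx ?(le_trans ax)//.
rewrite FE ?ax//; congr (_ + _); apply: eq_integral_on => t /andP[at_ tx].
by apply: fg; rewrite at_ (lt_le_trans tx).
Qed.

Lemma AC_cst a b k : AC a b (cst k) (cst 0).
Proof.
split; first exact: integrable_on_cst.
by move=> x /andP[ax xb]; rewrite integral_on_cst// mul0r addr0.
Qed.

Lemma AC_D a b F f G g : AC a b F f -> AC a b G g ->
  AC a b (fun x => F x + G x) (fun x => f x + g x).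
Proof.
move=> [fi FE] [gi GE]; split; first exact: integrable_onD.
move=> x xab; rewrite FE// GE//.
have [ax xb] := andP xab; rewrite RintegralD//; [ring|exact: integrable_onS fi|].
exact: integrable_onS gi.
Qed.

Lemma AC_Z a b k F f : AC a b F f -> AC a b (fun x => k * F x) (fun x => k * f x).
Proof.
move=> [fi FE]; split; first exact: integrable_onZ.
move=> x xab; rewrite FE//.
have [ax xb] := andP xab; rewrite RintegralZl//; [ring|exact: integrable_onS fi].
Qed.

Lemma AC_B a b F f G g : AC a b F f -> AC a b G g ->
  AC a b (fun x => F x - G x) (fun x => f x - g x).
Proof.
move=> FA /(AC_Z (-1)) GA; have := AC_D FA GA.
by apply: AC_eq => x _; rewrite mulN1r.
Qed.

Lemma AC_continuous a b F f : a <= b -> AC a b F f ->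
  {within `[a, b], continuous F}.
Proof.
move=> ab [fi FE].
have fi' := (integrable_on_closed _ _ _).1 fi.
have H := parameterized_integral_continuous ab fi'.
have : {within `[a, b], continuous
    (fun x => F a + parameterized_integral mu a x f)}.
  by move=> x; apply: cvgD; [exact: cvg_cst|exact: H].
apply: subspace_eq_continuous => x; rewrite inE/= in_itv/= => xab.
rewrite /from_subspace/= (FE x)//.
congr (_ + _); rewrite /parameterized_integral integral_on_closed//.
by case/andP: xab => _ xb; exact: integrable_onS fi.
Qed.

Lemma continuous_within_bounded a b F : {within `[a, b], continuous F} ->
  exists M, forall x, a <= x <= b -> `|F x| <= M.
Proof.
case: (leP a b) => [ab cF|ba _]; last first.
  exists 0 => x /andP[ax xb]; move: (le_trans ax xb); by rewrite leNgt ba.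
have [c _ cM] := EVT_max ab cF; have [d _ dm] := EVT_min ab cF.
exists (`|F c| + `|F d|) => x xab; have xab' : x \in `[a, b] by rewrite in_itv.
have := cM _ xab'; have := dm _ xab'.
have := ler_norm (F c); have := ler_norm (- F d); rewrite normrN.
have := normr_ge0 (F c); have := normr_ge0 (F d).
by move=> *; rewrite ler_norml; apply/andP; split; lra.
Qed.

Lemma AC_bounded a b F f : AC a b F f ->
  exists M, forall x, a <= x <= b -> `|F x| <= M.
Proof.
case: (leP a b) => [ab|ba _]; last first.
  exists 0 => x /andP[ax xb]; move: (le_trans ax xb); by rewrite leNgt ba.
by move/AC_continuous => /(_ ab); exact: continuous_within_bounded.
Qed.

Lemma AC_measurable a b F f : AC a b F f -> measurable_fun `]a, b[ F.
Proof.
case: (leP a b) => [ab|ba _]; last first.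
  rewrite set_itv_ge ?bnd_simp -?leNgt ?ltW//; exact: measurable_fun_set0.
move/AC_continuous => /(_ ab) cF.
have : measurable_fun `[a, b] F by exact: subspace_continuous_measurable_fun.
by apply: measurable_funS => //; apply: subset_itvScc; rewrite bnd_simp.
Qed.

Lemma continuous_derive_AC a b F f : (forall x : R, is_derive x 1 F (f x)) ->
  continuous f -> AC a b F f.
Proof.
move=> dF cf.
have fi c d : integrable_on c d f.
  apply/integrable_on_closed/continuous_compact_integrable.
    exact: segment_compact.
  exact: continuous_subspaceT.
split=> // x /andP[]; rewrite le_eqVlt => /predU1P[<- _|ax xb].
  by rewrite integral_on_empty// addr0.
have cF : continuous F.
  by move=> y; apply/differentiable_continuous/derivable1_diffP; case: (dF y).
rewrite -integral_on_closed// /Rintegral (@continuous_FTC2 _ f F a x ax)//=.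
- ring.
- exact: continuous_subspaceT.
- split=> [y _||]; first by case: (dF y).
  + exact: cvg_at_right_filter (cF a).
  + exact: cvg_at_left_filter (cF x).
- by move=> y _; rewrite derive1E derive_val.
Qed.

End IntervalIntegrals.

(** * Integration by parts *)

Section IntegrationByParts.
Context {R : realType}.
Notation mu := (@lebesgue_measure R).
Implicit Types (a b x : R) (f g F G : R -> R).

Let ind a b f : R -> R := f \_ `]a, b[.

Let indE a b f x : ind a b f x = if a < x < b then f x else 0.
Proof. by rewrite /ind patchE mem_setE in_itv. Qed.

Let integrable_ind a b f : integrable_on a b f ->
  mu.-integrable setT (EFin \o ind a b f).
Proof.
move=> fi; 
have := (@integrable_mkcond _ _ _ mu _ (EFin \o f) (measurable_itv `]a, b[)).1 fi.
apply: eq_integrable => // x _.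
by rewrite /= /ind !patchE; case: ifP.
Qed.

Let measurable_ind a b f : integrable_on a b f -> measurable_fun setT (ind a b f).
Proof. by move/integrable_ind/(measurable_int mu)/measurable_EFinP. Qed.

Let integral_ind a b f : integrable_on a b f ->
  (\int[mu]_x (ind a b f x)%:E)%E = (\int[mu]_(x in `]a, b[) f x)%:E.
Proof.
move=> fi; rewrite /Rintegral fineK; last exact: integrable_fin_num.
rewrite [RHS]integral_mkcond; apply: eq_integral => x _.
by rewrite /ind !patchE; case: ifP.
Qed.

Let integral_indZ a b f k : integrable_on a b f ->
  (\int[mu]_x (k * ind a b f x)%:E)%E = (k * \int[mu]_(x in `]a, b[) f x)%:E.
Proof.
move=> fi; rewrite EFinM -integral_ind// -integralZl//.
exact: integrable_ind.
Qed.

(** The condition t < s, with s = [z.1] and t = [z.2], sits in the integrand, so that Fubini is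
    applied on the whole plane with f and g extended by zero. *)
Let tri a b f g (z : R * R) : R :=
  ind a b f z.1 * ind a b g z.2 * (z.2 < z.1)%R%:R.

Let measurable_tri a b f g : integrable_on a b f -> integrable_on a b g ->
  measurable_fun setT (tri a b f g).
Proof.
move=> fi gi; apply: measurable_funM.
  apply: measurable_funM.
    exact: measurableT_comp (measurable_ind fi) measurable_fst.
  exact: measurableT_comp (measurable_ind gi) measurable_snd.
have -> : (fun z : R * R => (z.2 < z.1)%R%:R) =
    (fun z : R * R => if z.2 < z.1 then 1 else 0) :> (_ -> R).
  by apply/funext => z; case: ifP.
apply: measurable_fun_ifT => //.
by apply: measurable_fun_ltr; [exact: measurable_snd|exact: measurable_fst].
Qed.

(** The integrand is dominated by |f(s) g(t)|, whose iterated integral is a product of two finite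
    integrals. *)
Let integrable_tri a b f g : integrable_on a b f -> integrable_on a b g ->
  (mu \x mu)%E.-integrable setT (EFin \o tri a b f g).
Proof.
move=> fi gi.
have mt : measurable_fun setT (EFin \o tri a b f g).
  by apply/measurable_EFinP; exact: measurable_tri.
apply: (@le_integrable _ _ _ (mu \x mu)%E _ _ _
    (fun z : R * R => (ind a b f z.1 * ind a b g z.2)%:E)) => //.
  move=> z _; rewrite /= lee_fin /tri normrM.
  by case: (z.2 < z.1); rewrite ?normr1 ?mulr1// normr0 mulr0.
have mp : measurable_fun setT
    (fun z : R * R => (ind a b f z.1 * ind a b g z.2)%:E).
  apply/measurable_EFinP; apply: measurable_funM.
    exact: measurableT_comp (measurable_ind fi) measurable_fst.
  exact: measurableT_comp (measurable_ind gi) measurable_snd.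
apply/integrable12ltyP => //=.
under eq_integral => x _.
  under eq_integral => y _ do rewrite normrM.
  have -> : (\int[mu]_y (`|ind a b f x| * `|ind a b g y|)%:E)%E =
            (`|ind a b f x| * \int[mu]_y `|ind a b g y|)%:E.
    rewrite EFinM /Rintegral fineK; last first.
      by apply: integrable_fin_num => //; exact/integrable_norm/integrable_ind.
    rewrite -integralZl//; exact/integrable_norm/integrable_ind.
  over.
rewrite /=.
under eq_integral => x _ do rewrite mulrC EFinM.
rewrite integralZl//; last exact/integrable_norm/integrable_ind.
rewrite lte_mul_pinfty ?lee_fin ?Rintegral_ge0//.
by have /integrableP[] := integrable_ind fi.
Qed.

(* Fubini on the triangle a < t < s < b. *)
Lemma integral_triangle a b f g : integrable_on a b f -> integrable_on a b g ->
  \int[mu]_(s in `]a, b[) (f s * \int[mu]_(t in `]a, s[) g t) =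
  \int[mu]_(t in `]a, b[) (g t * \int[mu]_(s in `]t, b[) f s).
Proof.
move=> fi gi; have := Fubini (integrable_tri fi gi); rewrite /=.
under eq_integral => s _.
  have -> : (\int[mu]_t (tri a b f g (s, t))%:E)%E =
      (ind a b (fun s => f s * \int[mu]_(t in `]a, s[) g t) s)%:E.
    case: (boolP (a < s < b)) => sab; last first.
      under eq_integral do rewrite /tri /= indE (negbTE sab) !mul0r.
      by rewrite integral0 indE (negbTE sab).
    have [as_ sb] := andP sab.
    rewrite indE sab -integral_indZ; last exact: integrable_onS (lexx _) (ltW sb) gi.
    apply: eq_integral => t _; rewrite /tri /= !indE sab -mulrA; congr (_ * _)%:E.
    case: (ltP t s) => ts; rewrite ?andbF ?mulr0// mulr1.
    by rewrite (lt_trans ts sb) andbT.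
  over.
rewrite /=.
under [X in _ = X -> _]eq_integral => t _.
  have -> : (\int[mu]_s (tri a b f g (s, t))%:E)%E =
      (ind a b (fun t => g t * \int[mu]_(s in `]t, b[) f s) t)%:E.
    case: (boolP (a < t < b)) => tab; last first.
      under eq_integral do rewrite /tri /= [ind a b g _]indE (negbTE tab) mulr0 mul0r.
      by rewrite integral0 indE (negbTE tab).
    have [at_ tb] := andP tab.
    rewrite indE tab -integral_indZ; last exact: integrable_onS (ltW at_) (lexx _) fi.
    apply: eq_integral => s _; rewrite /tri /= !indE tab mulrAC mulrC; congr (_ * _)%:E.
    case: (ltP t s) => ts; rewrite ?mulr0//= mulr1.
    by rewrite (lt_trans at_ ts).
  over.
rewrite /= => H; rewrite [LHS]Rintegral_mkcond [RHS]Rintegral_mkcond.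
exact: (congr1 fine H).
Qed.

Lemma AC_integrableM a b F f g : AC a b F f -> integrable_on a b g ->
  integrable_on a b (fun x => F x * g x).
Proof.
move=> FA gi; have [M FM] := AC_bounded FA.
apply: (integrable_onMb (AC_measurable FA) _ gi) => x /andP[ax xb].
by apply: FM; rewrite !ltW.
Qed.

(** In int f G write G(t) = G(a) + int_a^t g, and in int F g write F(t) = F(x) - int_t^x f. By
    [integral_triangle] both double integrals equal int g T, with opposite signs, and what remains
    is F(x) G(x) - F(a) G(a). *)
Lemma AC_M a b F f G g : AC a b F f -> AC a b G g ->
  AC a b (fun x => F x * G x) (fun x => f x * G x + F x * g x).
Proof.
move=> FA GA; have [fi FE] := FA; have [gi GE] := GA.
have fGi : integrable_on a b (fun x => f x * G x).
  apply: eq_integrable_on (AC_integrableM GA fi) => x _; exact: mulrC.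
have Fgi := AC_integrableM FA gi.
split=> [|x xab]; first exact: integrable_onD.
have [ax xb] := andP xab.
have S := integrable_onS (lexx a) xb.
rewrite RintegralD//; [|exact: S|exact: S].
pose T t := \int[mu]_(s in `]t, x[) f s.
have E1 : \int[mu]_(t in `]a, x[) (f t * G t) =
    G a * \int[mu]_(t in `]a, x[) f t + \int[mu]_(t in `]a, x[) (g t * T t).
  rewrite -integral_triangle; [|exact: S|exact: S].
  rewrite -RintegralZl//; last exact: S.
  have EG t : a < t < x -> \int[mu]_(t0 in `]a, t[) g t0 = G t - G a.
    move=> /andP[at_ tx]; rewrite GE ?(ltW at_) ?(le_trans (ltW tx))//; ring.
  rewrite -RintegralD//; last 2 first.
  - exact/S/integrable_onZ.
  - apply: (eq_integrable_on (f := fun t => f t * G t - G a * f t)).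
      by move=> t tx; rewrite EG//; ring.
    by apply/S/integrable_onB => //; exact: integrable_onZ.
  by apply: eq_integral_on => t tx; rewrite EG//; ring.
have E2 : \int[mu]_(t in `]a, x[) (F t * g t) =
    F x * \int[mu]_(t in `]a, x[) g t - \int[mu]_(t in `]a, x[) (g t * T t).
  have ET t : a < t < x -> T t = F x - F t.
    move=> /andP[at_ tx]; rewrite (AC_incr FA)//; exact: ltW.
  rewrite -RintegralZl//; last exact: S.
  rewrite -RintegralB//; last 2 first.
  - exact/S/integrable_onZ.
  - apply: (eq_integrable_on (f := fun t => F x * g t - F t * g t)).
      by move=> t tx; rewrite ET//; ring.
    by apply/S/integrable_onB => //; exact: integrable_onZ.
  by apply: eq_integral_on => t tx; rewrite ET//; ring.
rewrite E1 E2 (GE x)// (FE x)//; ring.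
Qed.
End IntegrationByParts.

(** * Smooth bump functions *)

Section Derivatives.
Context {R : realType}.
Implicit Types (f g : R -> R) (x a b k : R).

Lemma is_derive_fun_eq f g x a b : (forall y, f y = g y) -> a = b ->
  is_derive x 1 f a -> is_derive x 1 g b.
Proof. by move=> /funext -> ->. Qed.

Lemma is_derive_funD f g x a b : is_derive x 1 f a -> is_derive x 1 g b ->
  is_derive x 1 (fun y => f y + g y) (a + b).
Proof. by move=> fa gb; exact: is_deriveD. Qed.

Lemma is_derive_funM f g x a b : is_derive x 1 f a -> is_derive x 1 g b ->
  is_derive x 1 (fun y => f y * g y) (a * g x + f x * b).
Proof.
move=> fa gb; apply: is_derive_fun_eq (is_deriveM fa gb) => //.
by rewrite addrC; congr (_ + _); rewrite /GRing.scale/= mulrC.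
Qed.

Lemma is_derive_funZ k f x a : is_derive x 1 f a ->
  is_derive x 1 (fun y => k * f y) (k * a).
Proof. by move=> fa; exact: (is_deriveZ k fa). Qed.

Lemma is_derive_continuous f g : (forall x, is_derive x 1 f (g x)) ->
  continuous f.
Proof.
move=> df y; apply/differentiable_continuous/derivable1_diffP.
by case: (df y).
Qed.

End Derivatives.

Section SmoothFunctions.
Context {R : realType}.
Implicit Types (f g : R -> R) (x a b k : R) (P Q : {poly R}).

(** A coinduction principle: each smoothness proof exhibits a class [S] closed under
    differentiation, and no formula for an n-th derivative is ever written. *)
Lemma smooth_coind (S : (R -> R) -> Prop) :
  (forall f, S f -> exists2 g, (forall x, is_derive x 1 f (g x)) & S g) ->
  forall f, S f -> smooth f.
Proof.
move=> H f Sf n; elim: n f Sf => [|n IH] f /H[g fg Sg] x.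
  by rewrite derive1n0; case: (fg x).
rewrite derive1Sn (_ : f^`()%classic = g); first exact: IH.
by apply/funext => y; rewrite derive1E; case: (fg y).
Qed.

Lemma smooth_derive1 f : smooth f -> smooth f^`()%classic.
Proof. by move=> sf n x; rewrite -derive1Sn; exact: sf. Qed.

Lemma smooth_is_derive f x : smooth f -> is_derive x 1 f (f^`()%classic x).
Proof. by move=> /(_ 0%N x); rewrite derive1n0 derive1E => /derivableP. Qed.

Lemma smooth_continuous f : smooth f -> continuous f.
Proof. by move=> sf; apply: is_derive_continuous => x; exact: smooth_is_derive. Qed.

Lemma smooth_primitive F f : (forall x, is_derive x 1 F (f x)) -> smooth f ->
  smooth F.
Proof.
move=> Ff sf; pose S h := h = F \/ smooth h.
apply: (@smooth_coind S); last by left.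
move=> h [->|sh]; first by exists f => //; right.
exists h^`()%classic; last by right; exact: smooth_derive1.
by move=> x; exact: smooth_is_derive.
Qed.

Lemma smoothD f g : smooth f -> smooth g -> smooth (fun x => f x + g x).
Proof.
move=> sf sg.
pose S h := exists u v, [/\ smooth u, smooth v & h = (fun x => u x + v x)].
apply: (@smooth_coind S); last by exists f, g.
move=> _ [u [v [su sv ->]]].
exists (fun x => u^`()%classic x + v^`()%classic x).
  by move=> x; apply: is_derive_funD; exact: smooth_is_derive.
exists u^`()%classic, v^`()%classic.
by split; [exact: smooth_derive1|exact: smooth_derive1|].
Qed.

Lemma smoothZ k f : smooth f -> smooth (fun x => k * f x).
Proof.
move=> sf; pose S h := exists2 u, smooth u & h = (fun x => k * u x).
apply: (@smooth_coind S); last by exists f.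
move=> _ [u su ->]; exists (fun x => k * u^`()%classic x).
  by move=> x; apply: is_derive_funZ; exact: smooth_is_derive.
exists u^`()%classic; [exact: smooth_derive1|by []].
Qed.

(** The function wanted is exp(-1/Q), with P = 1 and n = 0. The factors P and Q^-n make the family
    closed under differentiation for fixed Q, as [smooth_coind] requires. *)
Definition bump P Q n x : R :=
  if 0 < Q.[x] then P.[x] * Q.[x]^-1 ^+ n * expR (- Q.[x]^-1) else 0.

(** The exponential series gives exp(1/q) >= q^-(n+2) / (n+2)!. Two powers more than n are taken, so
    that q ^ 2 is left over: one factor is spent on the difference quotient, the other makes it tend
    to 0. *)
Lemma pow_expR_le (q : R) n : 0 < q ->
  q^-1 ^+ n * expR (- q^-1) <= n.+2`!%:R * q ^+ 2.
Proof.
move=> q0; rewrite expRN ler_pdivrMr ?expR_gt0//.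
have := @expR_ge1Dxn _ (q^-1) n.+1; rewrite invr_ge0 ltW// => /(_ isT) H.
have : q^-1 ^+ n.+2 / n.+2`!%:R <= expR q^-1 by apply: le_trans H; rewrite lerDr.
have c0 : 0 <= n.+2`!%:R * q ^+ 2 by rewrite mulr_ge0 ?exprn_ge0// ltW.
move=> /(ler_wpM2l c0)/(le_trans _); apply.
rewrite le_eqVlt; apply/orP; left; apply/eqP.
rewrite !exprS; field.
by rewrite pnatr_eq0 -lt0n fact_gt0 gt_eqF.
Qed.

(* Where Q <= 0, flatness: bump is O(Q ^ 2), and Q y <= Q y - Q x = O(y - x). *)
Lemma bump_derive_flat P Q n x : Q.[x] <= 0 -> is_derive x 1 (bump P Q n) 0.
Proof.
move=> Qx; apply/is_derive1_caratheodory.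
have bx : bump P Q n x = 0 by rewrite /bump ltNge Qx.
exists (fun z => bump P Q n z / (z - x)); split; last by rewrite bx mul0r.
  move=> z; rewrite bx subr0; have [->|zx] := eqVneq z x.
    by rewrite bx subrr mulr0.
  by rewrite divfK// subr_eq0.
rewrite /prop_for/continuous_at [X in _ --> X](_ : _ = 0); last by rewrite bx mul0r.
have /factor_theorem[H QH] : root (Q - Q.[x]%:P) x.
  by rewrite /root !hornerE subrr.
(* By [pow_expR_le] and Q(z) <= |H(z) (z - x)|, the difference quotient is at most (n+2)! |K(z)|;
   the factor z - x left in [K] makes this vanish at x. *)
pose K : R -> R := horner ('X * P * H ^+ 2 - x *: (P * H ^+ 2)).
have KE z : K z = (z - x) * P.[z] * H.[z] ^+ 2 by rewrite /K !hornerE /=; ring.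
have cK : K z @[z --> x] --> K x by exact: continuous_horner.
have Kx0 : `|K z| @[z --> x] --> `|K x| by exact: cvg_norm cK.
have Kx : n.+2`!%:R * `|K z| @[z --> x] --> (0 : R).
  rewrite -(mulr0 n.+2`!%:R); apply: cvgM; first exact: cvg_cst.
  by move: Kx0; rewrite [X in _ --> X -> _](_ : _ = 0)// KE subrr !mul0r normr0.
have Kx' : - (n.+2`!%:R * `|K z|) @[z --> x] --> (0 : R).
  by rewrite -oppr0; exact: cvgN.
apply: (squeeze_cvgr _ Kx' Kx); near=> z; rewrite -ler_norml.
have [->|zx] := eqVneq z x.
  by rewrite subrr invr0 mulr0 normr0 mulr_ge0// normr_ge0.
rewrite /bump; case: ifPn => Qz; last by rewrite mul0r normr0 mulr_ge0.
have Qzx : Q.[z] <= `|H.[z] * (z - x)|.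
  have : (Q - Q.[x]%:P).[z] = H.[z] * (z - x) by rewrite QH !hornerE.
  rewrite !hornerE => <-; apply: le_trans (ler_norm _).
  by rewrite lerBrDr; rewrite gerDl.
rewrite normrM normfV ler_pdivrMr ?normr_gt0 ?subr_eq0//.
rewrite -mulrA normrM [X in _ * X]ger0_norm//; last first.
  by rewrite mulr_ge0 ?expR_ge0 ?exprn_ge0 ?invr_ge0 ?ltW.
apply: (le_trans (ler_wpM2l (normr_ge0 _) (pow_expR_le n Qz))).
rewrite KE normrM normrX normrM.
have -> : n.+2`!%:R * (`|z - x| * `|P.[z]| * `|H.[z]| ^+ 2) * `|z - x| =
  `|P.[z]| * (n.+2`!%:R * (`|H.[z]| * `|z - x|) ^+ 2) by ring.
rewrite -normrM; apply: ler_wpM2l => //; apply: ler_wpM2l => //.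
by rewrite lerXn2r ?nnegrE ?(ltW Qz).
Unshelve. all: by end_near. Qed.

(** Where Q <= 0 both sides vanish by flatness. Where Q > 0 the condition is open, so the bump
    agrees near x with an ordinary product, and the quotient rule is put over the common denominator
    Q^(n+2). *)
Lemma bump_derive P Q n x : is_derive x 1 (bump P Q n)
  (bump (P^`() * Q ^+ 2 - n%:R *: (P * Q^`() * Q) + P * Q^`()) Q n.+2 x).
Proof.
case: (leP Q.[x] 0) => [Qx|Qx].
  by rewrite [X in is_derive _ _ _ X]/bump ltNge Qx; exact: bump_derive_flat.
have dP (y : R) : is_derive y 1 (horner P) P^`().[y] by exact: is_derive_poly.
have dQ (y : R) : is_derive y 1 (horner Q) Q^`().[y] by exact: is_derive_poly.
have Q0 : Q.[x] != 0 by rewrite gt_eqF.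
have dV : is_derive x 1 (fun y => Q.[y]^-1) (- Q.[x]^-1 ^+ 2 * Q^`().[x]).
  apply: is_derive_fun_eq (is_deriveV Q0 (dQ x)) => //.
  by rewrite /GRing.scale/= exprVn mulNr.
have dX := is_deriveX n dV.
have dE : is_derive x 1 (fun y => expR (- Q.[y]^-1))
    (expR (- Q.[x]^-1) * (Q.[x]^-1 ^+ 2 * Q^`().[x])).
  have dN := is_derive_funZ (-1) dV.
  apply: is_derive_fun_eq (is_derive1_comp (is_derive_expR _) dN).
    by move=> y; rewrite /= mulN1r.
  by rewrite /GRing.scale/= !mulN1r mulNr opprK.
have := is_derive_funM (is_derive_funM (dP x) dX) dE.
have near0 : \forall z \near x, 0 < Q.[z].
  exact: (cvgr_gt _ (@continuous_horner _ Q x)).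
move=> D.
have {}D := near_eq_is_derive (g := bump P Q n) _ D.
apply: is_derive_fun_eq (D _) => //.
  rewrite /bump Qx exprfctE /GRing.scale/= !(hornerD, hornerN, hornerM, hornerZ, horner_exp).
  set e := expR _; move: (Q.[x]) (P.[x]) (Q^`().[x]) (P^`().[x]) e Q0.
  (* The power rule produces the exponent [n.-1], which has to be resolved before [field]
     applies. *)
  move=> q p q' p' e q0; case: (n) => [|m].
    by field.
  rewrite -[m.+1.-1]/m (exprS _ m.+2) (exprS _ m.+1) (exprS _ m).
  by move: (q^-1 ^+ m) (m.+1%:R) => w k; field.
near=> z; rewrite /bump exprfctE.
have -> : 0 < Q.[z] by near: z.
by [].
Unshelve. all: by end_near. Qed.

Lemma smooth_bump P Q n : smooth (bump P Q n).
Proof.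
pose S f := exists P n, f = bump P Q n.
apply: (@smooth_coind S); last by exists P, n.
move=> _ [P' [m ->]].
exists (bump (P'^`() * Q ^+ 2 - m%:R *: (P' * Q^`() * Q) + P' * Q^`()) Q m.+2).
  by move=> x; exact: bump_derive.
by exists (P'^`() * Q ^+ 2 - m%:R *: (P' * Q^`() * Q) + P' * Q^`()), m.+2.
Qed.

End SmoothFunctions.

(** * Square integrable functions *)

Section SquareIntegrable.
Context {R : realType}.
Notation mu := (@lebesgue_measure R).
Implicit Types (a b c x k : R) (f g F G : R -> R).

(** Measurability is a separate clause because that of the square leaves the sign of f arbitrary. *)
Definition sqint a b f :=
  measurable_fun `]a, b[ f /\ integrable_on a b (fun x => f x ^+ 2).

Lemma integrable_le_on a b f g : measurable_fun `]a, b[ f ->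
  (forall x, a < x < b -> `|f x| <= g x) -> integrable_on a b g ->
  integrable_on a b f.
Proof.
move=> mf fg; apply: le_integrable => //; first exact/measurable_EFinP.
move=> x /=; rewrite in_itv/= => /fg; rewrite lee_fin => /le_trans; apply.
exact: ler_norm.
Qed.

Lemma le_integral_on a b f g : integrable_on a b f -> integrable_on a b g ->
  (forall x, a < x < b -> f x <= g x) ->
  \int[mu]_(x in `]a, b[) f x <= \int[mu]_(x in `]a, b[) g x.
Proof.
move=> fi gi fg; apply: le_Rintegral => // x /=; rewrite in_itv/=; exact: fg.
Qed.

Lemma sqint_integrableM a b f g : sqint a b f -> sqint a b g ->
  integrable_on a b (fun x => f x * g x).
Proof.
move=> [mf fi] [mg gi].
apply: (@integrable_le_on _ _ _ (fun x => f x ^+ 2 + g x ^+ 2)).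
- exact: measurable_funM.
- move=> x _; rewrite ler_norml; have := sqr_ge0 (f x + g x).
  have := sqr_ge0 (f x - g x); rewrite sqrrB sqrrD => h1 h2.
  have := sqr_ge0 (f x); have := sqr_ge0 (g x) => h3 h4.
  by apply/andP; split; lra.
- exact: integrable_onD.
Qed.

Lemma sqint_bounded a b f M : measurable_fun `]a, b[ f ->
  (forall x, a < x < b -> `|f x| <= M) -> sqint a b f.
Proof.
move=> mf fM; split=> //.
apply: (@integrable_on_bounded _ _ _ _ (M ^+ 2)).
  exact: measurable_funX.
move=> x xab; rewrite normrX lerXn2r ?nnegrE ?fM//.
by apply: le_trans (fM _ xab).
Qed.

Lemma sqint_cst a b k : sqint a b (cst k).
Proof. by apply: (@sqint_bounded _ _ _ `|k|). Qed.

Lemma sqint_integrable a b f : sqint a b f -> integrable_on a b f.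
Proof.
move=> fs; apply: eq_integrable_on (sqint_integrableM fs (sqint_cst a b 1)).
by move=> x _; rewrite mulr1.
Qed.

Lemma sqintMb a b f g M : measurable_fun `]a, b[ f ->
  (forall x, a < x < b -> `|f x| <= M) -> sqint a b g ->
  sqint a b (fun x => f x * g x).
Proof.
move=> mf fM [mg gi]; split; first exact: measurable_funM.
have : integrable_on a b (fun x => f x ^+ 2 * g x ^+ 2).
  apply: (@integrable_onMb _ _ _ _ _ (M ^+ 2)) gi; first exact: measurable_funX.
  move=> x xab; rewrite normrX lerXn2r ?nnegrE ?fM//.
  by apply: le_trans (fM _ xab).
by apply: eq_integrable_on => x _; rewrite exprMn.
Qed.

Lemma sqintZ a b k f : sqint a b f -> sqint a b (fun x => k * f x).
Proof. by apply: (@sqintMb _ _ _ _ `|k|). Qed.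

Lemma sqintD a b f g : sqint a b f -> sqint a b g ->
  sqint a b (fun x => f x + g x).
Proof.
move=> fs gs; split; first by apply: measurable_funD; [case: fs|case: gs].
have := integrable_onD (integrable_onD fs.2 gs.2)
          (integrable_onZ 2 (sqint_integrableM fs gs)).
by apply: eq_integrable_on => x _; ring.
Qed.

Lemma sqintB a b f g : sqint a b f -> sqint a b g ->
  sqint a b (fun x => f x - g x).
Proof.
move=> fs /(sqintZ (-1)) gs; have [m1 i1] := sqintD fs gs; split.
  by apply: eq_measurable_fun m1 => x _; rewrite mulN1r.
by apply: eq_integrable_on i1 => x _; rewrite mulN1r.
Qed.

Lemma eq_sqint a b f g : (forall x, a < x < b -> f x = g x) ->
  sqint a b f -> sqint a b g.
Proof.
move=> fg [mf fi]; split; last first.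
  by apply: eq_integrable_on fi => x /fg ->.
by apply: eq_measurable_fun mf => x; rewrite inE/= in_itv/= => /fg.
Qed.

Lemma sqintS a b c d f : a <= c -> d <= b -> sqint a b f -> sqint c d f.
Proof.
move=> ac db [mf fi]; split; last exact: integrable_onS fi.
apply: measurable_funS mf => //.
by apply: subset_itv; rewrite bnd_simp.
Qed.

Lemma sqint_ge0 a b f : 0 <= \int[mu]_(x in `]a, b[) (f x ^+ 2).
Proof. by apply: Rintegral_ge0 => x _; exact: sqr_ge0. Qed.

(** The quadratic A - 2 t C + t^2 B = int (f - t g)^2 is nonnegative for all t; its minimum is at t
    = C / B. *)
Lemma Cauchy_Schwarz a b f g : sqint a b f -> sqint a b g ->
  (\int[mu]_(x in `]a, b[) (f x * g x)) ^+ 2 <=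
  \int[mu]_(x in `]a, b[) (f x ^+ 2) * \int[mu]_(x in `]a, b[) (g x ^+ 2).
Proof.
move=> fs gs; set A := \int[mu]_(x in _) (f x ^+ 2).
set B := \int[mu]_(x in _) (g x ^+ 2); set C := \int[mu]_(x in _) (f x * g x).
have fg := sqint_integrableM fs gs; have [_ f2] := fs; have [_ g2] := gs.
have H t : 0 <= A - 2 * t * C + t ^+ 2 * B.
  rewrite -!RintegralZl// -RintegralB//; last exact: integrable_onZ.
  rewrite -RintegralD//; last exact: integrable_onZ.
    rewrite (eq_integral_on (g := fun x => (f x - t * g x) ^+ 2)) ?sqint_ge0//.
    by move=> x _; ring.
  by apply: integrable_onB => //; exact: integrable_onZ.
have A0 : 0 <= A by exact: sqint_ge0.
have [B0|B0] := eqVneq B 0.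
  rewrite B0 mulr0; have [->|C0] := eqVneq C 0; first by rewrite expr0n.
  (* With B = 0 the polynomial is affine in t, and this t gives it the value -1. *)
  have := H ((A + 1) / (2 * C)); rewrite B0 mulr0 addr0.
  rewrite (_ : A - _ = -1); last by field.
  by rewrite lerNr oppr0 ler10.
have Bp : 0 < B by rewrite lt_neqAle eq_sym B0 sqint_ge0.
have := H (C / B).
have -> : A - 2 * (C / B) * C + (C / B) ^+ 2 * B = (A * B - C ^+ 2) / B by field.
by rewrite pmulr_lge0 ?invr_gt0// subr_ge0.
Qed.

Lemma sqr_integral_le a b f : a <= b -> sqint a b f ->
  (\int[mu]_(x in `]a, b[) f x) ^+ 2 <=
  (b - a) * \int[mu]_(x in `]a, b[) (f x ^+ 2).
Proof.
move=> ab fs; have := Cauchy_Schwarz (sqint_cst a b 1) fs.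
rewrite (eq_integral_on (f := fun x => cst 1 x * f x) (g := f)); last first.
  by move=> x _; rewrite /= mul1r.
rewrite (eq_integral_on (f := fun x => cst 1 x ^+ 2) (g := cst 1)); last first.
  by move=> x _; rewrite /= expr1n.
by rewrite integral_on_cst// mul1r.
Qed.

Lemma integral_sqrD_le a b f g : sqint a b f -> sqint a b g ->
  \int[mu]_(x in `]a, b[) ((f x + g x) ^+ 2) <=
  2 * \int[mu]_(x in `]a, b[) (f x ^+ 2) + 2 * \int[mu]_(x in `]a, b[) (g x ^+ 2).
Proof.
move=> fs gs; have [_ f2] := fs; have [_ g2] := gs.
rewrite -!RintegralZl// -RintegralD//; last 2 first.
- exact: integrable_onZ.
- exact: integrable_onZ.
apply: le_integral_on.
- by case: (sqintD fs gs).
- by apply: integrable_onD; exact: integrable_onZ.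
- move=> x _; have := sqr_ge0 (f x - g x); rewrite sqrrB sqrrD; lra.
Qed.

Lemma AC_sqint a b F f : AC a b F f -> sqint a b F.
Proof.
move=> FA; have [M FM] := AC_bounded FA.
apply: sqint_bounded (AC_measurable FA) _ => x /andP[ax xb].
by apply: FM; rewrite !ltW.
Qed.

Lemma continuous_sqint a b f : continuous f -> sqint a b f.
Proof.
move=> cf; have cf' : {within `[a, b], continuous f} by exact: continuous_subspaceT.
have [M fM] := continuous_within_bounded cf'.
apply: (@sqint_bounded _ _ _ M); last by move=> x /andP[ax xb]; apply: fM; rewrite !ltW.
by apply: measurable_funTS; exact: continuous_measurable_fun.
Qed.

End SquareIntegrable.

(** * Approximation by test functions *)

Section TestFunctionApproximation.
Context {R : realType}.
Notation mu := (@lebesgue_measure R).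
Implicit Types (a b c d x k e : R) (f g w u : R -> R).

(** A bracketing interval, possibly empty, stands for the compact support: min and max of its end
    points serve sums, and a primitive need only be examined left of c and right of d. *)
Definition real_test a b f := smooth f /\
  exists c d, [/\ a < c, d < b & forall x, ~~ (c <= x <= d) -> f x = 0].

Lemma real_testS a b c d f : c <= a -> b <= d -> real_test a b f ->
  real_test c d f.
Proof.
move=> ca bd [sf [a' [b' [aa' b'b f0]]]]; split=> //; exists a', b'.
by split=> //; [exact: le_lt_trans aa'|exact: lt_le_trans bd].
Qed.

Lemma real_testZ a b k f : real_test a b f -> real_test a b (fun x => k * f x).
Proof.
move=> [sf [c [d [ac db f0]]]]; split; first exact: smoothZ.
by exists c, d; split=> // x /f0 ->; rewrite mulr0.
Qed.

Lemma real_testD a b f g : real_test a b f -> real_test a b g ->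
  real_test a b (fun x => f x + g x).
Proof.
move=> [sf [c [d [ac db f0]]]] [sg [c' [d' [ac' d'b g0]]]].
split; first exact: smoothD.
exists (Num.min c c'), (Num.max d d'); split; first by rewrite lt_min ac.
  by rewrite gt_max db.
move=> x; rewrite ge_min le_max => H; rewrite f0 ?g0 ?addr0//.
  by apply: contraNN H => /andP[-> ->]; rewrite !orbT.
by apply: contraNN H => /andP[-> ->].
Qed.

Lemma real_test_continuous a b f : real_test a b f -> continuous f.
Proof. by move=> [/smooth_continuous]. Qed.

Lemma real_test_sqint a b c d f : real_test a b f -> sqint c d f.
Proof. by move=> /real_test_continuous; exact: continuous_sqint. Qed.

Lemma real_test_out a b f x : real_test a b f -> ~~ (a < x < b) -> f x = 0.
Proof.
move=> [_ [c [d [ac db f0]]]] H; apply: f0; apply: contraNN H => /andP[cx xd].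
by rewrite (lt_le_trans ac cx) (le_lt_trans xd db).
Qed.

Lemma real_test_support a b f : a < b -> real_test a b f ->
  exists c d, [/\ a < c, c < d, d < b & forall x, ~~ (c < x < d) -> f x = 0].
Proof.
move=> ab [_ [c [d [ac db f0]]]].
pose m := (a + b) / 2.
exists (Num.min ((a + c) / 2) ((a + m) / 2)), (Num.max ((d + b) / 2) ((m + b) / 2)).
rewrite /m; split.
- by rewrite lt_min; apply/andP; split; lra.
- by rewrite gt_min !lt_max; apply/orP; right; apply/orP; right; lra.
- by rewrite gt_max; apply/andP; split; lra.
- move=> x H; apply: f0; apply: contraNN H => /andP[cx xd].
  by rewrite gt_min lt_max; apply/andP; split; apply/orP; left; lra.
Qed.

(** The tolerance bounds the square of the L_2 distance, so errors on adjacent intervals simply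
    add. *)
Definition L2_approx a b w e := exists2 f, real_test a b f &
  sqint a b (fun x => w x - f x) /\
  \int[mu]_(x in `]a, b[) ((w x - f x) ^+ 2) <= e.

Lemma L2_approx_le a b w e e' : e <= e' -> L2_approx a b w e ->
  L2_approx a b w e'.
Proof. by move=> ee' [f tf [sf fe]]; exists f => //; split=> //; exact: le_trans ee'. Qed.

Lemma eq_L2_approx a b w w' e : (forall x, a < x < b -> w x = w' x) ->
  L2_approx a b w e -> L2_approx a b w' e.
Proof.
move=> ww [f tf [sf fe]]; exists f => //; split.
  by apply: eq_sqint sf => x xab; rewrite ww.
rewrite -(eq_integral_on (f := fun x => (w x - f x) ^+ 2))// => x xab.
by rewrite ww.
Qed.

Lemma sqint_glue a b c f : sqint a b f -> sqint b c f -> sqint a c f.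
Proof.
move=> [m1 i1] [m2 i2]; split; last exact: integrable_on_glue i1 i2.
case: (leP b a) => [ba|ab].
  apply: measurable_funS m2 => //.
  by apply: subset_itv; rewrite bnd_simp.
case: (leP c b) => [cb|bc].
  apply: measurable_funS m1 => //.
  by apply: subset_itv; rewrite bnd_simp.
rewrite (setU_oo ab bc); apply/measurable_funU => //; split=> //.
exact/measurable_fun_itv_bndo_bndcP.
Qed.

(** Each test function vanishes on the interval of the other, so their sum is the approximation on
    both. No matching at b is required, and w may jump there. *)
Lemma L2_approx_glue a b c w e e' : a <= b -> b <= c ->
  L2_approx a b w e -> L2_approx b c w e' -> L2_approx a c w (e + e').
Proof.
move=> ab bc [f tf [sf fe]] [g tg [sg ge]].
exists (fun x => f x + g x).
  by apply: real_testD; [exact: real_testS tf|exact: real_testS tg].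
have E1 x : a < x < b -> w x - f x = w x - (f x + g x).
  move=> /andP[ax xb]; rewrite (real_test_out tg) ?addr0//.
  by rewrite ltNge (ltW xb).
have E2 x : b < x < c -> w x - g x = w x - (f x + g x).
  move=> /andP[bx xc]; rewrite (real_test_out tf) ?add0r//.
  by rewrite [x < b]ltNge (ltW bx) andbF.
have s1 := eq_sqint E1 sf; have s2 := eq_sqint E2 sg.
have s := sqint_glue s1 s2; split=> //.
rewrite (integral_on_split ab bc); last by case: s.
apply: lerD.
  rewrite -(eq_integral_on (f := fun x => (w x - f x) ^+ 2))// => x xab.
  by rewrite E1.
rewrite -(eq_integral_on (f := fun x => (w x - g x) ^+ 2))// => x xab.
by rewrite E2.
Qed.

Lemma L2_approx_cst1 a b e : a < b -> 0 < e -> L2_approx a b (cst 1) e.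
Proof.
move=> ab e0.
set L := b - a; have L0 : 0 < L by rewrite subr_gt0.
(* The error is at most 4 dl from the two margins of width 2 dl plus s L from the middle, that is 2
   s L in all; this s gives s < 1 and 2 s L <= e. *)
pose s := e / (2 * L + e).
have D0 : 0 < 2 * L + e by rewrite addr_gt0// mulr_gt0.
have s0 : 0 < s by rewrite divr_gt0.
have s1 : s < 1 by rewrite ltr_pdivrMr// mul1r ltrDr mulr_gt0.
have sL : 2 * s * L <= e.
  rewrite /s; have -> : 2 * (e / (2 * L + e)) * L = e * (2 * L) / (2 * L + e).
    by field; rewrite gt_eqF.
  by rewrite ler_pdivrMr// ler_pM2l// lerDl ltW.
pose dl := s * L / 4.
have dl0 : 0 < dl by rewrite divr_gt0// mulr_gt0.
have dlL : 4 * dl < b - a.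
  by rewrite /dl mulrC divfK// -[ltRHS]mul1r ltr_pM2r.
(* On the middle part both linear factors of Q are at least dl, so this scaling gives Q >= 1/s
   there, whence 1 - exp(-1/Q) <= 1/Q <= s. *)
pose kp := (s * dl ^+ 2)^-1.
have kp0 : 0 < kp by rewrite invr_gt0 mulr_gt0// exprn_gt0.
pose Q : {poly R} := kp *: (('X - (a + dl)%:P) * ((b - dl)%:P - 'X)).
have QE x : Q.[x] = kp * ((x - (a + dl)) * (b - dl - x)).
  by rewrite /Q !(hornerZ, hornerM, hornerD, hornerN, hornerX, hornerC).
pose f := bump 1 Q 0.
have fE x : f x = if 0 < Q.[x] then expR (- Q.[x]^-1) else 0.
  by rewrite /f /bump hornerC expr0 !mul1r.
have tf : real_test a b f.
  split; first exact: smooth_bump.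
  exists (a + dl), (b - dl); split; [lra|lra|].
  move=> x; rewrite negb_and -!ltNge => H; rewrite fE ifN// -leNgt QE.
  rewrite pmulr_rle0//; case/orP: H => H.
    by rewrite nmulr_rle0; lra.
  by rewrite pmulr_rle0; lra.
have f01 x : 0 <= f x <= 1.
  rewrite fE; case: ifP => Qx; last by rewrite lexx ler01.
  by rewrite expR_ge0 expR_le1 oppr_le0 invr_ge0 ltW.
have fs x : a + 2 * dl <= x <= b - 2 * dl -> 1 - f x <= s.
  move=> /andP[ax xb].
  have H : s^-1 <= Q.[x].
    rewrite QE; have -> : s^-1 = kp * dl ^+ 2.
      by rewrite /kp; field; rewrite !gt_eqF.
    rewrite ler_pM2l// expr2; apply: ler_pM; lra.
  have Qx : 0 < Q.[x] by apply: lt_le_trans H; rewrite invr_gt0.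
  rewrite fE Qx; have := expR_ge1Dx (- Q.[x]^-1).
  have : Q.[x]^-1 <= s by rewrite -[leRHS]invrK lef_pV2// posrE ?invr_gt0.
  lra.
have sf : sqint a b (fun x => cst 1 x - f x).
  by apply: sqintB; [exact: sqint_cst|exact: real_test_sqint tf].
exists f => //; split=> //.
have i1 : integrable_on a b (fun x => 1 - f x) by exact: sqint_integrable.
have le1 : \int[mu]_(x in `]a, b[) ((cst 1 x - f x) ^+ 2) <=
           \int[mu]_(x in `]a, b[) (1 - f x).
  apply: le_integral_on => //; first by case: sf.
  move=> x _ /=; rewrite expr2; have /andP[f0 f1] := f01 x.
  by rewrite ler_piMl ?subr_ge0// lerBlDr lerDl.
apply: (le_trans le1).
have e1 : a <= a + 2 * dl by lra.
have e2 : a + 2 * dl <= b by lra.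
have e3 : a + 2 * dl <= b - 2 * dl by lra.
have e4 : b - 2 * dl <= b by lra.
rewrite (integral_on_split e1 e2)// (integral_on_split e3 e4); last first.
  exact: integrable_onS i1.
have B x y k : x <= y -> a <= x -> y <= b ->
    (forall t, x < t < y -> 1 - f t <= k) ->
    \int[mu]_(t in `]x, y[) (1 - f t) <= k * (y - x).
  move=> xy ax yb H; rewrite -integral_on_cst//.
  apply: le_integral_on => //; last exact: integrable_on_cst.
  exact: integrable_onS i1.
have b1 : \int[mu]_(t in `]a, a + 2 * dl[) (1 - f t) <= 1 * (a + 2 * dl - a).
  apply: B => // t _; rewrite lerBlDr lerDl; by have /andP[] := f01 t.
have b2 : \int[mu]_(t in `]b - 2 * dl, b[) (1 - f t) <= 1 * (b - (b - 2 * dl)).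
  apply: B => //; first lra.
  by move=> t _; rewrite lerBlDr lerDl; have /andP[] := f01 t.
have b3 : \int[mu]_(t in `]a + 2 * dl, b - 2 * dl[) (1 - f t) <=
    s * (b - 2 * dl - (a + 2 * dl)).
  apply: B => // t /andP[t1 t2]; apply: fs; by rewrite !ltW.
have b4 : s * (b - 2 * dl - (a + 2 * dl)) <= s * L.
  by rewrite ler_pM2l// /L; lra.
have dE : 4 * dl = s * L by rewrite /dl mulrC divfK.
lra.
Qed.

Lemma L2_approx_cst a b k e : a < b -> 0 < e -> L2_approx a b (cst k) e.
Proof.
move=> ab e0; have e'0 : 0 < e / (k ^+ 2 + 1).
  by rewrite divr_gt0// ltr_wpDl ?sqr_ge0.
have [f tf [sf fe]] := L2_approx_cst1 ab e'0.
exists (fun x => k * f x); first exact: real_testZ.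
have E x : k * (cst 1 x - f x) = cst k x - k * f x by rewrite /= mulrBr mulr1.
split; first by apply: eq_sqint (sqintZ k sf) => x _.
have -> : \int[mu]_(x in `]a, b[) ((cst k x - k * f x) ^+ 2) =
    k ^+ 2 * \int[mu]_(x in `]a, b[) ((cst 1 x - f x) ^+ 2).
  rewrite -RintegralZl//; last by case: sf.
  by apply: eq_integral_on => x _; rewrite -E exprMn.
apply: (le_trans (ler_wpM2l (sqr_ge0 k) fe)).
rewrite mulrA ler_pdivrMr ?ltr_wpDl ?sqr_ge0// mulrC ler_pM2l//.
by rewrite lerDl.
Qed.

(** The midpoint value k serves as the constant. Splitting w - f = (w - k) + (k - f) costs 2 s^2 (b
    - a) for the first term, and s^2 (b - a) for the second with the tolerance chosen in the
    proof. *)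
Lemma L2_approx_near_cst a b w (s : R) : a < b -> 0 < s ->
  measurable_fun `]a, b[ w ->
  (forall x y, a < x < b -> a < y < b -> `|w x - w y| <= s) ->
  L2_approx a b w (3 * s ^+ 2 * (b - a)).
Proof.
move=> ab s0 mw ws; set k := w ((a + b) / 2).
have wk x : a < x < b -> `|w x - k| <= s.
  by move=> xab; apply: ws => //; apply/andP; split; lra.
have e0 : 0 < s ^+ 2 * (b - a) / 2.
  by rewrite divr_gt0// mulr_gt0 ?exprn_gt0// subr_gt0.
have [f tf [sf fe]] := L2_approx_cst k ab e0.
have sw : sqint a b (fun x => w x - k).
  by apply: sqint_bounded wk; exact: measurable_funB.
have E x : (w x - k) + (cst k x - f x) = w x - f x by rewrite /=; ring.
exists f => //; split.
  by apply: eq_sqint (sqintD sw sf) => x _; rewrite E.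
rewrite (eq_integral_on (g := fun x => ((w x - k) + (cst k x - f x)) ^+ 2));
  last by move=> x _; rewrite E.
apply: (le_trans (integral_sqrD_le sw sf)).
have : \int[mu]_(x in `]a, b[) ((w x - k) ^+ 2) <= s ^+ 2 * (b - a).
  rewrite -(integral_on_cst _ (ltW ab)).
  apply: (@le_integral_on _ _ _ (fun x => (w x - k) ^+ 2) (cst (s ^+ 2))).
  - by case: sw.
  - exact: integrable_on_cst.
  - move=> x /wk H; rewrite -[leLHS]real_normK ?num_real//.
    by rewrite lerXn2r ?nnegrE ?(ltW s0).
lra.
Qed.

(** On a grid of mesh at most [dl] each cell contributes 3 s^2 times its length, so the total is 3
    s^2 (b - a), whatever the number of cells. *)
Lemma L2_approx_uc a b w : a < b -> measurable_fun `]a, b[ w ->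
  (forall s : R, 0 < s -> exists2 dl : R, 0 < dl & forall x y, a < x < b -> a < y < b ->
     `|x - y| <= dl -> `|w x - w y| <= s) ->
  forall e, 0 < e -> L2_approx a b w e.
Proof.
move=> ab mw uc e e0; set L := b - a; have L0 : 0 < L by rewrite subr_gt0.
have D0 : 0 < 3 * L + e by rewrite addr_gt0// mulr_gt0.
pose s := e / (3 * L + e).
have s0 : 0 < s by rewrite divr_gt0.
have s1 : s <= 1 by rewrite ler_pdivrMr// mul1r lerDr mulr_ge0// ltW.
have sL : 3 * s ^+ 2 * L <= e.
  apply: (@le_trans _ _ (3 * s * L)).
    by rewrite ler_pM2r// ler_pM2l// expr2 ler_piMl// ltW.
  rewrite /s; have -> : 3 * (e / (3 * L + e)) * L = e * (3 * L) / (3 * L + e).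
    by field; rewrite gt_eqF.
  by rewrite ler_pdivrMr// ler_pM2l// lerDl ltW.
have [dl dl0 wdl] := uc s s0.
pose N := (Num.truncn (L / dl)).+1.
have N0 : (0 : R) < N%:R by rewrite ltr0n.
pose l := L / N%:R.
have l0 : 0 < l by rewrite divr_gt0.
have ldl : l <= dl.
  rewrite ler_pdivrMr// -ler_pdivrMl// mulrC ltW//.
  by have /andP[_] := @truncn_itv _ (L / dl) (divr_ge0 (ltW L0) (ltW dl0)).
have NlL : N%:R * l = L by rewrite /l mulrC divfK// gt_eqF.
have cell n : (n < N)%N -> L2_approx (a + n%:R * l) (a + n.+1%:R * l) w
    (3 * s ^+ 2 * l).
  move=> nN; have nl : n.+1%:R * l = n%:R * l + l by rewrite -natr1; ring.
  have bb : a + n.+1%:R * l <= b.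
    have : n.+1%:R * l <= N%:R * l by rewrite ler_pM2r// ler_nat.
    by rewrite NlL /L; lra.
  have aa : a <= a + n%:R * l by rewrite lerDl mulr_ge0// ltW.
  have E : 3 * s ^+ 2 * l =
      3 * s ^+ 2 * ((a + n.+1%:R * l) - (a + n%:R * l)) by rewrite nl; ring.
  rewrite E; apply: L2_approx_near_cst => //.
  - by rewrite nl; lra.
  - apply: measurable_funS mw => //.
    by apply: subset_itv; rewrite bnd_simp.
  - move=> x y /andP[x1 x2] /andP[y1 y2]; apply: wdl; [lra|lra|].
    by rewrite ler_norml; apply/andP; split; lra.
suff H n : (0 < n <= N)%N ->
    L2_approx a (a + n%:R * l) w (3 * s ^+ 2 * (n%:R * l)).
  have := H N; rewrite leqnn => /(_ isT); rewrite NlL.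
  by rewrite (_ : a + L = b) /L; [exact: L2_approx_le|ring].
elim: n => // n IH /= nN.
case: (posnP n) => [n0|n0].
  have := cell 0%N isT; rewrite n0 mul0r addr0; apply: L2_approx_le.
  by rewrite mul1r.
have {}IH : L2_approx a (a + n%:R * l) w (3 * s ^+ 2 * (n%:R * l)).
  by apply: IH; rewrite n0 ltnW.
have := L2_approx_glue _ _ IH (cell n nN).
have -> : 3 * s ^+ 2 * (n%:R * l) + 3 * s ^+ 2 * l = 3 * s ^+ 2 * (n.+1%:R * l).
  by rewrite -natr1; ring.
apply=> //; first by rewrite lerDl mulr_ge0// ltW.
by rewrite lerD2l ler_pM2r// ler_nat.
Qed.

(** By Cauchy-Schwarz, |F(x) - F(y)|^2 <= |x - y| int f^2, which is Hoelder continuity of exponent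
    1/2. The B + 1 in the choice of [dl] avoids a division by zero. *)
Lemma AC_uniform_continuity a b F f : AC a b F f -> sqint a b f ->
  forall s : R, 0 < s -> exists2 dl : R, 0 < dl &
    forall x y, a <= x <= b -> a <= y <= b -> `|x - y| <= dl ->
      `|F x - F y| <= s.
Proof.
move=> FA fs s s0; set B := \int[mu]_(x in `]a, b[) (f x ^+ 2).
have B0 : 0 <= B by exact: sqint_ge0.
have B1 : 0 < B + 1 by rewrite ltr_wpDl.
exists (s ^+ 2 / (B + 1)); first by rewrite divr_gt0// exprn_gt0.
move=> x y; wlog xy : x y / x <= y => [H|].
  move=> xab yab; case: (leP x y) => [xy|/ltW yx]; first exact: H.
  by rewrite distrC (distrC (F x)); exact: H.
move=> /andP[ax xb] /andP[ay yb].
rewrite distrC ger0_norm ?subr_ge0// => xyd; rewrite distrC.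
rewrite (AC_incr FA ax xy yb).
rewrite -(@ler_pXn2r _ 2)// ?nnegrE ?(ltW s0)// real_normK ?num_real//.
have fs' : sqint x y f by exact: sqintS fs.
apply: (le_trans (sqr_integral_le xy fs')).
have BB : \int[mu]_(t in `]x, y[) (f t ^+ 2) <= B.
  rewrite /B (integral_on_split ax xb); last by case: fs.
  rewrite (integral_on_split xy yb); last by case: (sqintS ax (lexx b) fs).
  have := sqint_ge0 a x f; have := sqint_ge0 y b f; lra.
apply: (@le_trans _ _ (s ^+ 2 / (B + 1) * B)).
  by apply: ler_pM => //; [rewrite subr_ge0|exact: sqint_ge0].
rewrite mulrAC ler_pdivrMr// ler_pM2l ?exprn_gt0//; lra.
Qed.

(** Integrating from minus infinity makes the primitive vanish left of the support and yields its
    derivative at every real point. *)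
Lemma compact_support_primitive c d f : continuous f ->
  (forall x, ~~ (c <= x <= d) -> f x = 0) ->
  exists F, (forall x : R, is_derive x 1 F (f x)) /\ forall x, x < c -> F x = 0.
Proof.
move=> cf f0; exists (fun x => \int[mu]_(t in `]-oo, x]) f t).
have fi : mu.-integrable setT (EFin \o f).
  have fcd : mu.-integrable `[c, d] (EFin \o f).
    apply: continuous_compact_integrable; first exact: segment_compact.
    exact: continuous_subspaceT.
  have := (@integrable_mkcond _ _ _ mu `[c, d] (EFin \o f) (measurable_itv _)).1 fcd.
  apply: eq_integrable => // x _; rewrite patchE mem_setE in_itv /=.
  by case: ifPn => // /f0 ->.
split=> [x|x xc].
  have xx : x < x + 1 by rewrite ltrDl.
  have fi' : mu.-integrable `]-oo, x + 1] (EFin \o f) by exact: integrableS fi.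
  have [D E] := continuous_FTC1 xx fi' (ltNyr _) (cf x).
  by rewrite -E derive1E; exact: derivableP.
rewrite (@eq_Rintegral _ _ _ mu _ (cst 0)).
  by rewrite Rintegral_cst//= mul0r.
move=> t; rewrite inE/= in_itv/= => tx; apply: f0.
by rewrite negb_and -ltNge (le_lt_trans tx xc).
Qed.

(** To the right of the support the primitive is constant, equal to the total integral; mean zero is
    what makes it a test function again. *)
Lemma real_test_primitive a b f : a < b -> real_test a b f ->
  \int[mu]_(x in `]a, b[) f x = 0 ->
  exists F, real_test a b F /\ forall x : R, is_derive x 1 F (f x).
Proof.
move=> ab tf f0; have [c [d [ac cd db fcd]]] := real_test_support ab tf.
have cf := real_test_continuous tf.
have fcd' x : ~~ (c <= x <= d) -> f x = 0.
  by move=> H; apply: fcd; apply: contraNN H => /andP[/ltW -> /ltW ->].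
have [F [FD F0]] := compact_support_primitive cf fcd'.
exists F; split=> //; split; first by apply: smooth_primitive FD _; case: tf.
exists c, d; split=> // x; rewrite negb_and -!ltNge => /orP[/F0//|dx].
have Fa : F a = 0 by exact: F0.
(* The point x may lie beyond b, so the interval has to contain both. *)
have FA : AC a (Num.max x b) F f by exact: continuous_derive_AC.
have xm : x <= Num.max x b by rewrite le_max lexx.
have bm : b <= Num.max x b by rewrite le_max lexx orbT.
have ad : a <= d by rewrite ltW// (lt_trans ac).
have tail y : d <= y -> y <= Num.max x b -> F y = F d.
  move=> dy ym; apply/eqP; rewrite -subr_eq0 (AC_incr FA)//.
  rewrite (eq_integral_on (g := cst 0)); last first.
    by move=> t /andP[dt _]; apply: fcd; rewrite negb_and -!leNgt (ltW dt) orbT.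
  by rewrite integral_on_cst// mul0r.
rewrite tail ?(ltW dx)// -(tail b) ?(ltW db)//.
by have := AC_incr FA (lexx a) (ltW ab) bm; rewrite Fa subr0 f0.
Qed.

(** Let psi approximate w and let m be its mean. The function psi - m g1 has mean zero, so its
    primitive F is a test function; and u - F vanishes at 0, so it is controlled by w - F'. *)
Lemma H10_approx u w : AC 0 1 u w -> sqint 0 1 w -> u 0 = 0 -> u 1 = 0 ->
  (forall e, 0 < e -> L2_approx 0 1 w e) ->
  forall e, 0 < e -> exists2 f, real_test 0 1 f &
    \int[mu]_(x in `]0, 1[) ((u x - f x) ^+ 2) +
    \int[mu]_(x in `]0, 1[) ((w x - f^`()%classic x) ^+ 2) <= e.
Proof.
move=> uA ws u0 u1 H e e0; have l01 : (0 : R) <= 1 by exact: ler01.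
(* Any tolerance below 1 would do: the integral of g0 is then within a distance less than 1 of 1,
   hence positive, and g0 can be normalised. *)
have q0 : (0 : R) < 1 / 4 by rewrite divr_gt0.
have [g0 tg0 [sg0 g0e]] := L2_approx_cst1 ltr01 q0.
set I0 := \int[mu]_(x in `]0, 1[) g0 x.
have i0 : integrable_on 0 1 g0 by exact/sqint_integrable/(real_test_sqint _ _ tg0).
have I0p : 0 < I0.
  have := le_trans (sqr_integral_le l01 sg0) (ler_wpM2l _ g0e).
  rewrite subr0 ler01 mul1r => /(_ isT).
  rewrite RintegralB//; last exact: integrable_on_cst.
  rewrite integral_on_cst// subr0 mul1r -/I0 => H1.
  rewrite ltNge; apply/negP => I0n.
  have : 1 <= (1 - I0) ^+ 2 by rewrite expr_ge1//; lra.
  lra.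
pose g1 x := I0^-1 * g0 x.
have tg1 : real_test 0 1 g1 by exact: real_testZ.
have sg1 : sqint 0 1 g1 := real_test_sqint _ _ tg1.
set B := \int[mu]_(x in `]0, 1[) (g1 x ^+ 2).
have B0 : 0 <= B by exact: sqint_ge0.
have B1 : 0 < 1 + B by rewrite ltr_pwDl.
(* Call this tolerance e1. It bounds both the squared error of psi and m^2, and 2 e1 + 2 e1 B = e /
   2; the other half of e goes to u - F. *)
have e10 : 0 < e / (4 * (1 + B)) by rewrite divr_gt0// mulr_gt0.
have [psi tpsi [spsi psie]] := H _ e10.
have sp : sqint 0 1 psi := real_test_sqint _ _ tpsi.
set m := \int[mu]_(x in `]0, 1[) psi x.
have intg1 : \int[mu]_(x in `]0, 1[) g1 x = 1.
  by rewrite RintegralZl// -/I0 mulVf// gt_eqF.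
have tchi : real_test 0 1 (fun x => psi x + (- m) * g1 x).
  by apply: real_testD => //; exact: real_testZ.
have [F [tF FD]] : exists F, real_test 0 1 F /\
    forall x : R, is_derive x 1 F (psi x + (- m) * g1 x).
  apply: real_test_primitive tchi _; first exact: ltr01.
  rewrite RintegralD//; [|exact: sqint_integrable|exact/sqint_integrable/sqintZ].
  by rewrite RintegralZl ?intg1//; [rewrite -/m; ring|exact: sqint_integrable].
have F'E x : F^`()%classic x = psi x + (- m) * g1 x.
  by rewrite derive1E; case: (FD x).
exists F => //.
have wE x : w x - F^`()%classic x = (w x - psi x) + m * g1 x by rewrite F'E; ring.
(* As w has integral u(1) - u(0) = 0, the number -m is the mean of w - psi. *)
have m2 : m ^+ 2 <= e / (4 * (1 + B)).
  have : (\int[mu]_(x in `]0, 1[) (w x - psi x)) ^+ 2 <= e / (4 * (1 + B)).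
    by apply: le_trans (sqr_integral_le l01 spsi) _; rewrite subr0 mul1r.
  rewrite RintegralB//; [|by case: uA|exact: sqint_integrable].
  by rewrite -(AC_incr uA) ?lexx// u0 u1 subrr sub0r sqrrN.
have sD : sqint 0 1 (fun x => w x - F^`()%classic x).
  apply: eq_sqint (sqintD spsi (sqintZ m sg1)) => x _; by rewrite wE.
have E1 : \int[mu]_(x in `]0, 1[) ((w x - F^`()%classic x) ^+ 2) <= e / 2.
  rewrite (eq_integral_on (g := fun x => ((w x - psi x) + m * g1 x) ^+ 2));
    last by move=> x _; rewrite wE.
  apply: le_trans (integral_sqrD_le spsi (sqintZ m sg1)) _.
  have -> : \int[mu]_(x in `]0, 1[) ((m * g1 x) ^+ 2) = m ^+ 2 * B.
    rewrite -RintegralZl//; last by case: sg1.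
    by apply: eq_integral_on => x _; rewrite exprMn.
  have H1 : m ^+ 2 * B <= e / (4 * (1 + B)) * B by exact: ler_wpM2r.
  have H2 : 2 * (e / (4 * (1 + B))) + 2 * (e / (4 * (1 + B)) * B) = e / 2.
    by field; rewrite gt_eqF.
  by rewrite -H2; apply: lerD; apply: ler_wpM2l.
have cF' : continuous (fun x => psi x + (- m) * g1 x).
  exact: real_test_continuous tchi.
have FA : AC 0 1 F (fun x => psi x + (- m) * g1 x).
  exact: continuous_derive_AC.
have dA : AC 0 1 (fun x => u x - F x) (fun x => w x - F^`()%classic x).
  by apply: AC_eq (AC_B uA FA) => // x _; rewrite F'E.
have F0 : F 0 = 0 by rewrite (real_test_out tF)// ltxx.
have sq x : 0 < x < 1 -> (u x - F x) ^+ 2 <=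
    \int[mu]_(x in `]0, 1[) ((w x - F^`()%classic x) ^+ 2).
  move=> /andP[x0 x1].
  have <- : (u x - F x) - (u 0 - F 0) = u x - F x by rewrite u0 F0 !subr0.
  rewrite (AC_incr dA (lexx 0) (ltW x0) (ltW x1)).
  have sx := sqintS (lexx 0) (ltW x1) sD.
  apply: le_trans (sqr_integral_le (ltW x0) sx) _.
  have [_ i1] := sD.
  rewrite (integral_on_split (ltW x0) (ltW x1))//.
  have J1 := sqint_ge0 0 x (fun x => w x - F^`()%classic x).
  have J2 := sqint_ge0 x 1 (fun x => w x - F^`()%classic x).
  apply: (@le_trans _ _ (1 * \int[mu]_(x in `]0, x[) ((w x - F^`()%classic x) ^+ 2))).
    by apply: ler_wpM2r => //; rewrite subr0 ltW.
  by rewrite mul1r lerDl.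
have E2 : \int[mu]_(x in `]0, 1[) ((u x - F x) ^+ 2) <= e / 2.
  apply: le_trans E1.
  rewrite -[leRHS]mulr1 -[X in _ <= _ * X](subr0 1) -(integral_on_cst _ l01).
  apply: (@le_integral_on _ _ _ (fun x => (u x - F x) ^+ 2) (cst _)).
  - by have [] := AC_sqint dA.
  - exact: integrable_on_cst.
  - exact: sq.
lra.
Qed.

End TestFunctionApproximation.

(** * Complex-valued functions *)

Local Open Scope complex_scope.

Section ComplexParts.
Context {R : realType}.
Implicit Types (z w : R[i]) (f g : R -> R[i]).

Lemma ReD z w : complex.Re (z + w) = complex.Re z + complex.Re w.
Proof. by case: z w => [? ?] [? ?]. Qed.

Lemma ImD z w : complex.Im (z + w) = complex.Im z + complex.Im w.
Proof. by case: z w => [? ?] [? ?]. Qed.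

Lemma ReN z : complex.Re (- z) = - complex.Re z.
Proof. by case: z. Qed.

Lemma ImN z : complex.Im (- z) = - complex.Im z.
Proof. by case: z. Qed.

Lemma ReM z w : complex.Re (z * w) =
  complex.Re z * complex.Re w - complex.Im z * complex.Im w.
Proof. by case: z w => [? ?] [? ?]. Qed.

Lemma ImM z w : complex.Im (z * w) =
  complex.Re z * complex.Im w + complex.Im z * complex.Re w.
Proof. by case: z w => [? ?] [? ?]. Qed.

Lemma complex_eq z w : complex.Re z = complex.Re w ->
  complex.Im z = complex.Im w -> z = w.
Proof. by case: z w => [? ?] [? ?] /= -> ->. Qed.

Lemma normc_sqr z : ComplexField.Normc.normc z ^+ 2 =
  complex.Re z ^+ 2 + complex.Im z ^+ 2.
Proof. by case: z => a b /=; rewrite sqr_sqrtr// addr_ge0 ?sqr_ge0. Qed.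

Definition partE := (ReD, ImD, ReN, ImN, ReM, ImM).

End ComplexParts.

Section ComplexAC.
Context {R : realType}.
Notation mu := (@lebesgue_measure R).
Implicit Types (a b c d x e : R) (F f G g u v w P Q : R -> R[i]) (k : R[i]).

Definition cAC a b F f :=
  AC a b (re_part F) (re_part f) /\ AC a b (im_part F) (im_part f).

Lemma cAC_eq a b F f G g : (forall x, a <= x <= b -> F x = G x) ->
  (forall x, a < x < b -> f x = g x) -> cAC a b F f -> cAC a b G g.
Proof.
move=> FG fg [H1 H2]; split; [apply: AC_eq H1|apply: AC_eq H2] => x xab;
  by rewrite /re_part /im_part ?FG// ?fg.
Qed.

Lemma cAC_S a b c d F f : a <= c -> d <= b -> cAC a b F f -> cAC c d F f.
Proof. by move=> ac db [H1 H2]; split; [apply: AC_S H1|apply: AC_S H2]. Qed.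

Lemma cAC_glue a b c F f : cAC a b F f -> cAC b c F f -> a <= b -> cAC a c F f.
Proof.
by move=> [H1 H2] [H3 H4] ab; split; [apply: AC_glue H1 H3 ab|apply: AC_glue H2 H4 ab].
Qed.

Lemma cAC_cst a b k : cAC a b (cst k) (cst 0).
Proof. by split; exact: AC_cst. Qed.

Lemma cAC_D a b F f G g : cAC a b F f -> cAC a b G g ->
  cAC a b (fun x => F x + G x) (fun x => f x + g x).
Proof.
move=> [H1 H2] [H3 H4].
split; [apply: AC_eq (AC_D H1 H3)|apply: AC_eq (AC_D H2 H4)] => x _;
  by rewrite /re_part /im_part ?partE.
Qed.

Lemma cAC_M a b F f G g : cAC a b F f -> cAC a b G g ->
  cAC a b (fun x => F x * G x) (fun x => f x * G x + F x * g x).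
Proof.
move=> [H1 H2] [H3 H4]; split.
  apply: AC_eq (AC_B (AC_M H1 H3) (AC_M H2 H4)) => x _;
    by rewrite /re_part /im_part ?partE; ring.
apply: AC_eq (AC_D (AC_M H1 H4) (AC_M H2 H3)) => x _;
  by rewrite /re_part /im_part ?partE; ring.
Qed.

Lemma cAC_Z a b k F f : cAC a b F f ->
  cAC a b (fun x => k * F x) (fun x => k * f x).
Proof.
move=> /(cAC_M (cAC_cst a b k)); apply: cAC_eq => x _ //.
by rewrite mul0r add0r.
Qed.

Lemma cAC_B a b F f G g : cAC a b F f -> cAC a b G g ->
  cAC a b (fun x => F x - G x) (fun x => f x - g x).
Proof.
move=> FA /(cAC_Z (-1)) GA; have := cAC_D FA GA.
by apply: cAC_eq => x _; rewrite mulN1r.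
Qed.

Definition cintegrable f :=
  integrable_on 0 1 (re_part f) /\ integrable_on 0 1 (im_part f).

Lemma cAC_cintegrable F f : cAC 0 1 F f -> cintegrable f.
Proof. by move=> [[H1 _] [H2 _]]. Qed.

Lemma cAC_cintegral F f : cAC 0 1 F f -> cintegral f = F 1 - F 0.
Proof.
move=> [H1 H2]; apply: complex_eq; rewrite /= /unit_itv !partE.
  by rewrite -(AC_incr H1) ?lexx.
by rewrite -(AC_incr H2) ?lexx.
Qed.

Lemma eq_cintegral f g : (forall x, 0 < x < 1 -> f x = g x) ->
  cintegral f = cintegral g.
Proof.
move=> fg; congr (_ +i* _); apply: eq_integral_on => x /fg;
  by rewrite /re_part /im_part => ->.
Qed.

Lemma cintegralD f g : cintegrable f -> cintegrable g ->
  cintegral (fun x => f x + g x) = cintegral f + cintegral g.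
Proof.
move=> [fr fi] [gr gi]; apply: complex_eq; rewrite partE /= /unit_itv -RintegralD//;
  by apply: eq_integral_on => x _; rewrite /re_part /im_part partE.
Qed.

Lemma cintegralN f : cintegrable f ->
  cintegral (fun x => - f x) = - cintegral f.
Proof.
move=> [fr fi]; apply: complex_eq; rewrite partE /= /unit_itv -mulN1r -RintegralZl//;
  by apply: eq_integral_on => x _; rewrite /re_part /im_part partE mulN1r.
Qed.

Lemma cintegralB f g : cintegrable f -> cintegrable g ->
  cintegral (fun x => f x - g x) = cintegral f - cintegral g.
Proof.
move=> fi gi; have gN : cintegrable (fun x => - g x).
  case: gi => [gr gi]; split.
    by apply: eq_integrable_on (integrable_onZ (-1) gr) => x _;
      rewrite /re_part partE mulN1r.
  by apply: eq_integrable_on (integrable_onZ (-1) gi) => x _;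
    rewrite /im_part partE mulN1r.
by rewrite -cintegralN// -cintegralD.
Qed.

Definition csq f := sqint 0 1 (re_part f) /\ sqint 0 1 (im_part f).

Definition sqnorm f : R := \int[mu]_(x in `]0, 1[) (re_part f x ^+ 2) +
  \int[mu]_(x in `]0, 1[) (im_part f x ^+ 2).

Lemma sqnorm_ge0 f : 0 <= sqnorm f.
Proof. by rewrite addr_ge0// sqint_ge0. Qed.

Lemma L2P f : L2 f <-> csq f.
Proof.
have E x : (ComplexField.Normc.normc (f x) ^+ 2)%:E =
    (re_part f x ^+ 2 + im_part f x ^+ 2)%:E by rewrite normc_sqr.
split=> [[mr mi fi]|[[mr ir] [mi ii]]].
  have S : integrable_on 0 1 (fun x => re_part f x ^+ 2 + im_part f x ^+ 2).
    apply/integrableP; split.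
      by apply/measurable_EFinP; apply: measurable_funD; exact: measurable_funX.
    apply: le_lt_trans fi; rewrite le_eqVlt; apply/orP; left; apply/eqP.
    apply: eq_integral => x _; rewrite E /= ger0_norm//.
    by rewrite addr_ge0 ?sqr_ge0.
  split; split=> //; apply: integrable_le_on S; first exact: measurable_funX.
    by move=> x _; rewrite ger0_norm ?sqr_ge0// lerDl sqr_ge0.
    exact: measurable_funX.
  by move=> x _; rewrite ger0_norm ?sqr_ge0// lerDr sqr_ge0.
split=> //; have /integrableP[_] := integrable_onD ir ii.
apply: le_lt_trans; rewrite le_eqVlt; apply/orP; left; apply/eqP.
apply: eq_integral => x _; rewrite E /= ger0_norm//.
by rewrite addr_ge0 ?sqr_ge0.
Qed.

Lemma L2normE f : csq f -> L2norm f = Num.sqrt (sqnorm f).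
Proof.
move=> [[mr ir] [mi ii]]; congr Num.sqrt; rewrite /sqnorm -RintegralD//.
by apply: eq_integral_on => x _; rewrite normc_sqr.
Qed.

Lemma L2norm_sqr f : csq f -> L2norm f ^+ 2 = sqnorm f.
Proof. by move=> fs; rewrite L2normE// sqr_sqrtr// sqnorm_ge0. Qed.

Lemma eq_csq f g : (forall x, 0 < x < 1 -> f x = g x) -> csq f -> csq g.
Proof.
by move=> fg [fr fi]; split; [apply: eq_sqint fr|apply: eq_sqint fi] => x /fg;
  rewrite /re_part /im_part => ->.
Qed.

Lemma csqD f g : csq f -> csq g -> csq (fun x => f x + g x).
Proof.
move=> [fr fi] [gr gi]; split.
  by apply: eq_sqint (sqintD fr gr) => x _; rewrite /re_part partE.
by apply: eq_sqint (sqintD fi gi) => x _; rewrite /im_part partE.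
Qed.

Lemma csqB f g : csq f -> csq g -> csq (fun x => f x - g x).
Proof.
move=> [fr fi] [gr gi]; split.
  by apply: eq_sqint (sqintB fr gr) => x _; rewrite /re_part !partE.
by apply: eq_sqint (sqintB fi gi) => x _; rewrite /im_part !partE.
Qed.

Lemma csqMb f g (M : R) : measurable_fun unit_itv (re_part f) ->
  measurable_fun unit_itv (im_part f) ->
  (forall x, 0 < x < 1 -> `|re_part f x| <= M /\ `|im_part f x| <= M) ->
  csq g -> csq (fun x => f x * g x).
Proof.
move=> mr mi fM [gr gi].
have rM x : 0 < x < 1 -> `|re_part f x| <= M by move=> /fM[].
have iM x : 0 < x < 1 -> `|im_part f x| <= M by move=> /fM[].
split.
  apply: eq_sqint (sqintB (sqintMb mr rM gr) (sqintMb mi iM gi)) => x _.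
  by rewrite /re_part !partE.
apply: eq_sqint (sqintD (sqintMb mr rM gi) (sqintMb mi iM gr)) => x _.
by rewrite /im_part !partE.
Qed.

Lemma csq_cintegrableM f g : csq f -> csq g -> cintegrable (fun x => f x * g x).
Proof.
move=> [fr fi] [gr gi]; split.
  apply: eq_integrable_on (integrable_onB (sqint_integrableM fr gr)
    (sqint_integrableM fi gi)) => x _; by rewrite /re_part !partE.
apply: eq_integrable_on (integrable_onD (sqint_integrableM fr gi)
    (sqint_integrableM fi gr)) => x _; by rewrite /im_part !partE.
Qed.

Lemma csq_cintegrable f : csq f -> cintegrable f.
Proof. by move=> [fr fi]; split; exact: sqint_integrable. Qed.

Lemma cAC_csq F f : cAC 0 1 F f -> csq F.
Proof. by move=> [H1 H2]; split; [exact: AC_sqint H1|exact: AC_sqint H2]. Qed.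

Lemma csqM_cAC F g f : cAC 0 1 F g -> csq f -> csq (fun x => F x * f x).
Proof.
move=> [Fr Fi]; have [[M1 H1] [M2 H2]] := (AC_bounded Fr, AC_bounded Fi).
apply: (@csqMb _ _ (M1 + M2)); [exact: AC_measurable Fr|exact: AC_measurable Fi|].
move=> x /andP[/ltW x0 /ltW x1]; have x01 : 0 <= x <= 1 by rewrite x0.
have h1 := H1 _ x01; have h2 := H2 _ x01.
have n1 := le_trans (normr_ge0 _) h1; have n2 := le_trans (normr_ge0 _) h2.
by split; lra.
Qed.

(** The pairing carries no conjugate. Each part is a sum or difference of two real pairings, and (p
    - q)^2 <= 2 p^2 + 2 q^2 accounts for the factor 2. *)
Lemma cCauchy_Schwarz f g : csq f -> csq g ->
  complex.Re (cintegral (fun x => f x * g x)) ^+ 2 <= 2 * sqnorm f * sqnorm g /\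
  complex.Im (cintegral (fun x => f x * g x)) ^+ 2 <= 2 * sqnorm f * sqnorm g.
Proof.
move=> [fr fi] [gr gi].
have rr := Cauchy_Schwarz fr gr; have ii := Cauchy_Schwarz fi gi.
have ri := Cauchy_Schwarz fr gi; have ir := Cauchy_Schwarz fi gr.
rewrite /= /unit_itv.
have -> : \int[mu]_(x in `]0, 1[) re_part (fun x => f x * g x) x =
    \int[mu]_(x in `]0, 1[) (re_part f x * re_part g x) -
    \int[mu]_(x in `]0, 1[) (im_part f x * im_part g x).
  rewrite -RintegralB//; [|exact: sqint_integrableM|exact: sqint_integrableM].
  by apply: eq_integral_on => x _; rewrite /re_part partE.
have -> : \int[mu]_(x in `]0, 1[) im_part (fun x => f x * g x) x =
    \int[mu]_(x in `]0, 1[) (re_part f x * im_part g x) +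
    \int[mu]_(x in `]0, 1[) (im_part f x * re_part g x).
  rewrite -RintegralD//; [|exact: sqint_integrableM|exact: sqint_integrableM].
  by apply: eq_integral_on => x _; rewrite /im_part partE.
move: rr ii ri ir; rewrite /sqnorm.
have := sqint_ge0 0 1 (re_part f); have := sqint_ge0 0 1 (im_part f).
have := sqint_ge0 0 1 (re_part g); have := sqint_ge0 0 1 (im_part g).
set A := \int[mu]_(x in _) (re_part f x ^+ 2).
set B := \int[mu]_(x in _) (im_part f x ^+ 2).
set C := \int[mu]_(x in _) (re_part g x ^+ 2).
set D := \int[mu]_(x in _) (im_part g x ^+ 2).
set p := \int[mu]_(x in _) _; set q := \int[mu]_(x in _) _.
set r := \int[mu]_(x in _) _; set s := \int[mu]_(x in _) _.
move=> D0 C0 B0 A0 pp qq rr ss.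
have AD := mulr_ge0 A0 D0; have BC := mulr_ge0 B0 C0.
have AC' := mulr_ge0 A0 C0; have BD := mulr_ge0 B0 D0.
split; first by have := sqr_ge0 (p + q); rewrite sqrrD sqrrB; lra.
by have := sqr_ge0 (r - s); rewrite sqrrB sqrrD; lra.
Qed.

End ComplexAC.

(** * Weak derivatives and the symmetry of the operator *)

Section WeakDerivatives.
Context {R : realType}.
Notation mu := (@lebesgue_measure R).
Implicit Types (a b c d x e : R) (F f G g u v w P Q phi : R -> R[i]) (k : R[i]).

Lemma test_fun_derive phi : test_fun phi -> forall x : R,
  is_derive x 1 (re_part phi) (re_part (cderiv phi) x) /\
  is_derive x 1 (im_part phi) (im_part (cderiv phi) x).
Proof. by move=> [sr si _] x; split; exact: smooth_is_derive. Qed.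

Lemma test_fun_cAC a b phi : test_fun phi -> cAC a b phi (cderiv phi).
Proof.
move=> tphi; have D := test_fun_derive tphi; have [sr si _] := tphi.
split; apply: continuous_derive_AC.
- by move=> x; case: (D x).
- exact/smooth_continuous/smooth_derive1.
- by move=> x; case: (D x).
- exact/smooth_continuous/smooth_derive1.
Qed.

Lemma test_fun_csq phi : test_fun phi -> csq phi.
Proof. by move=> /(test_fun_cAC 0 1)/cAC_csq. Qed.

Lemma test_fun_cderiv_csq phi : test_fun phi -> csq (cderiv phi).
Proof.
move=> [sr si _]; split; apply: continuous_sqint;
  exact/smooth_continuous/smooth_derive1.
Qed.

Lemma test_fun_out phi x : test_fun phi -> ~~ (0 < x < 1) -> phi x = 0.
Proof.
move=> [_ _ [K [_ K01 K0]]] x01; apply: K0 => /K01.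
by rewrite /unit_itv/= in_itv/= => H; rewrite H in x01.
Qed.

Lemma real_test_fun (f g : R -> R) : real_test 0 1 f -> real_test 0 1 g ->
  test_fun (fun x => f x +i* g x).
Proof.
move=> [sf [c [d [c0 d1 f0]]]] [sg [c' [d' [c'0 d'1 g0]]]]; split=> //.
exists (`[Num.min c c', Num.max d d']%classic); split.
- exact: segment_compact.
- move=> x; rewrite /unit_itv /= !in_itv/= => /andP[h1 h2]; apply/andP; split.
    by apply: lt_le_trans h1; rewrite lt_min c0.
  by apply: le_lt_trans h2 _; rewrite gt_max d1.
- move=> x /=; rewrite in_itv/= => /negP; rewrite ge_min le_max => H.
  rewrite f0 ?g0//; apply: contraNN H => /andP[-> ->]; rewrite ?orbT//.
Qed.

Lemma cintegrable_loc f : cintegrable f -> loc_integrable f.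
Proof. by move=> [fr fi]; split; apply: open_integrable_locally. Qed.

Lemma eq_cintegrable f g : (forall x, 0 < x < 1 -> f x = g x) ->
  cintegrable f -> cintegrable g.
Proof.
by move=> fg [fr fi]; split; [apply: eq_integrable_on fr|apply: eq_integrable_on fi];
  move=> x /fg; rewrite /re_part /im_part => ->.
Qed.

Lemma cAC_cintegrableM F f g : cAC 0 1 F f -> cintegrable g ->
  cintegrable (fun x => g x * F x).
Proof.
move=> [FR FI] [gr gi]; split.
  apply: eq_integrable_on (integrable_onB (AC_integrableM FR gr)
    (AC_integrableM FI gi)) => x _; by rewrite /re_part /im_part partE; ring.
apply: eq_integrable_on (integrable_onD (AC_integrableM FR gi)
    (AC_integrableM FI gr)) => x _; by rewrite /re_part /im_part partE; ring.
Qed.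

(** The product rule against a test function, whose boundary terms vanish. Here [F'] is another
    representative of F on (0,1), not a derivative: it will be a (p / a), equal to p only where a is
    nonzero. *)
Lemma cAC_weak_deriv F f F' : cAC 0 1 F f ->
  (forall x, 0 < x < 1 -> F x = F' x) -> weak_deriv F' f.
Proof.
move=> FA FF; have fi := cAC_cintegrable FA.
split.
- apply/cintegrable_loc/(eq_cintegrable FF)/csq_cintegrable/(cAC_csq FA).
- exact: cintegrable_loc.
- move=> phi tphi; have pA := test_fun_cAC 0 1 tphi.
  have M := cAC_M FA pA.
  have i1 : cintegrable (fun x => F x * cderiv phi x).
    apply: csq_cintegrableM; first exact: cAC_csq FA.
    exact: test_fun_cderiv_csq.
  have i2 := cAC_cintegrableM pA fi.
  have := cAC_cintegral M; rewrite cintegralD//.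
  rewrite !(test_fun_out tphi) ?ltxx ?andbF// !mulr0 subrr => /eqP.
  rewrite addrC addr_eq0 => /eqP <-.
  by apply: eq_cintegral => x /FF ->.
Qed.

Lemma H1normE u w : csq u -> csq w ->
  H1norm u w = Num.sqrt (sqnorm u + sqnorm w).
Proof. by move=> us ws; rewrite /H1norm !L2norm_sqr. Qed.

Lemma cAC_H10 u w : cAC 0 1 u w -> csq w -> u 0 = 0 -> u 1 = 0 ->
  (forall e, 0 < e -> L2_approx 0 1 (re_part w) e) ->
  (forall e, 0 < e -> L2_approx 0 1 (im_part w) e) ->
  H10 u w.
Proof.
move=> uA ws u0 u1 Hr Hi; have us := cAC_csq uA; split.
  by split; [exact/L2P|exact/L2P|exact: cAC_weak_deriv uA _].
move=> e e0; have e40 : 0 < e ^+ 2 / 4 by rewrite divr_gt0// exprn_gt0.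
have e2 : e ^+ 2 / 4 + e ^+ 2 / 4 < e ^+ 2 by have := exprn_gt0 2 e0; lra.
have [[uAr uAi] [wr wi]] := (uA, ws).
have [||f tf fe] := H10_approx uAr wr _ _ Hr e40.
- by rewrite /re_part u0.
- by rewrite /re_part u1.
have [||g tg ge] := H10_approx uAi wi _ _ Hi e40.
- by rewrite /im_part u0.
- by rewrite /im_part u1.
have tfg := real_test_fun tf tg.
exists (fun x => f x +i* g x) => //.
rewrite H1normE; last 2 first.
- exact/csqB/test_fun_csq.
- exact/csqB/test_fun_cderiv_csq.
rewrite -[ltRHS]ger0_norm ?(ltW e0)// -sqrtr_sqr ltr_sqrt ?exprn_gt0//.
apply: le_lt_trans e2; apply: le_trans (lerD fe ge).
rewrite le_eqVlt; apply/orP; left; apply/eqP; rewrite /sqnorm addrACA.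
by congr (_ + _ + (_ + _)); apply: eq_integral_on => x _;
  rewrite /re_part /im_part !partE.
Qed.

Lemma sqr_small_eq0 (z C : R) : 0 <= C ->
  (forall e, 0 < e -> z ^+ 2 <= C * e) -> z = 0.
Proof.
move=> C0 H; apply/eqP; rewrite -sqrf_eq0 eq_le sqr_ge0 andbT leNgt.
apply/negP => z0; have C1 : 0 < C + 1 by rewrite ltr_wpDl.
have := H _ (divr_gt0 z0 C1); rewrite mulrA ler_pdivlMr// mulrC.
by rewrite ler_pM2r// => h; lra.
Qed.

(* Both sides are L_2-continuous in (v, dv), so test functions suffice. *)
Lemma weak_deriv_H10 P Q v dv : csq P -> csq Q -> weak_deriv P Q -> H10 v dv ->
  cintegral (fun x => P x * dv x) = - cintegral (fun x => Q x * v x).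
Proof.
move=> Ps Qs [_ _ PQ] [[/L2P vs /L2P dvs _] vd].
apply/eqP; rewrite -subr_eq0 opprK; apply/eqP.
set z := _ + _.
(* The weak derivative identity cancels the contribution of phi, so z pairs P and Q with the
   differences dv - phi' and v - phi only, and these are small. *)
have key e : 0 < e -> exists A B : R[i], z = A + B /\
   [/\ complex.Re A ^+ 2 <= 2 * sqnorm P * e, complex.Im A ^+ 2 <= 2 * sqnorm P * e,
       complex.Re B ^+ 2 <= 2 * sqnorm Q * e & complex.Im B ^+ 2 <= 2 * sqnorm Q * e].
  move=> e0; have se0 : 0 < Num.sqrt e by rewrite sqrtr_gt0.
  have [phi tphi] := vd _ se0.
  have s1 : csq (fun x => v x - phi x) by apply/csqB => //; exact: test_fun_csq.
  have s2 : csq (fun x => dv x - cderiv phi x).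
    by apply/csqB => //; exact: test_fun_cderiv_csq.
  rewrite H1normE// ltr_sqrt// => phie.
  exists (cintegral (fun x => P x * (dv x - cderiv phi x))).
  exists (cintegral (fun x => Q x * (v x - phi x))); split.
    have Pphi := csq_cintegrableM Ps (test_fun_cderiv_csq tphi).
    have Qphi := csq_cintegrableM Qs (test_fun_csq tphi).
    have Pdv := csq_cintegrableM Ps dvs; have Qv := csq_cintegrableM Qs vs.
    rewrite (eq_cintegral (g := fun x => P x * dv x - P x * cderiv phi x));
      last by move=> x _; rewrite mulrBr.
    rewrite (eq_cintegral (f := fun x => Q x * (v x - phi x))
      (g := fun x => Q x * v x - Q x * phi x)); last by move=> x _; rewrite mulrBr.
    by rewrite !cintegralB// PQ// opprK addrACA addrN addr0.
  have [r1 i1] := cCauchy_Schwarz Ps s2; have [r2 i2] := cCauchy_Schwarz Qs s1.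
  have P0 : 0 <= 2 * sqnorm P by rewrite mulr_ge0// sqnorm_ge0.
  have Q0 : 0 <= 2 * sqnorm Q by rewrite mulr_ge0// sqnorm_ge0.
  have N1 := sqnorm_ge0 (fun x => v x - phi x).
  have N2 := sqnorm_ge0 (fun x => dv x - cderiv phi x).
  have L1 := ler_wpM2l Q0 (_ : sqnorm (fun x => v x - phi x) <= e).
  have L2 := ler_wpM2l P0 (_ : sqnorm (fun x => dv x - cderiv phi x) <= e).
  split; [apply: le_trans r1 (L2 _)|apply: le_trans i1 (L2 _)|
          apply: le_trans r2 (L1 _)|apply: le_trans i2 (L1 _)]; lra.
have C0 : 0 <= 4 * (sqnorm P + sqnorm Q) by rewrite mulr_ge0// addr_ge0// sqnorm_ge0.
apply: complex_eq; apply: (sqr_small_eq0 C0) => e /key[A [B [-> [h1 h2 h3 h4]]]];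
  rewrite partE.
  have := sqr_ge0 (complex.Re A - complex.Re B); rewrite sqrrB sqrrD; lra.
have := sqr_ge0 (complex.Im A - complex.Im B); rewrite sqrrB sqrrD; lra.
Qed.

Lemma ae_eq_cintegral f g : cintegrable f -> cintegrable g -> ae_eq01 f g ->
  cintegral f = cintegral g.
Proof.
move=> [fr fi] [gr gi] fg; congr (_ +i* _); congr fine; apply: ae_eq_integral.
- exact: measurable_itv.
- exact: measurable_int fr.
- exact: measurable_int gr.
- by apply: filterS fg => x H /H; rewrite /re_part => ->.
- exact: measurable_itv.
- exact: measurable_int fi.
- exact: measurable_int gi.
- by apply: filterS fg => x H /H; rewrite /im_part => ->.
Qed.

Lemma ae_eq01M f g h : ae_eq01 f g ->
  ae_eq01 (fun x => f x * h x) (fun x => g x * h x).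
Proof. by apply: filterS => x H /H ->. Qed.

Lemma ae_eq01_sqnorm f g : csq f -> csq g -> sqnorm (fun x => f x - g x) = 0 ->
  ae_eq01 f g.
Proof.
move=> fs gs /eqP; have [[mr ir] [mi ii]] := csqB fs gs.
rewrite paddr_eq0 ?sqint_ge0// => /andP[/eqP r0 /eqP i0].
have ae0 (h : R -> R) : measurable_fun unit_itv h ->
    integrable_on 0 1 (fun x => h x ^+ 2) ->
    \int[mu]_(x in `]0, 1[) (h x ^+ 2) = 0 -> \forall x \ae mu, unit_itv x -> h x = 0.
  move=> mh ih h0.
  have : ae_eq mu unit_itv (fun x => (h x ^+ 2)%:E) (cst 0%E).
    apply/ae_eq_integral_abs; [exact: measurable_itv|exact: measurable_int ih|].
    transitivity (\int[mu]_(x in `]0%R, 1%R[) (h x ^+ 2)%:E)%E.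
      by apply: eq_integral => x _; rewrite /= ger0_norm ?sqr_ge0.
    by rewrite -[LHS]fineK; [congr _%:E|exact: integrable_fin_num].
  by apply: filterS => x H /H/= [] /eqP; rewrite sqrf_eq0 => /eqP.
move: (ae0 _ mr ir r0) (ae0 _ mi ii i0); apply: filterS2 => [|x Hr Hi x01].
  exact: (ae_filter_ringOfSetsType mu).
apply: complex_eq; apply/eqP; rewrite -subr_eq0; apply/eqP.
  by have := Hr x01; rewrite /re_part !partE.
by have := Hi x01; rewrite /im_part !partE.
Qed.

Lemma ae_eq01_L2norm f g : csq f -> csq g -> ae_eq01 f g -> L2norm f = L2norm g.
Proof.
move=> [[mfr _] [mfi _]] [[mgr _] [mgi _]] fg.
rewrite /L2norm; congr Num.sqrt; congr fine.
have mN (h : R -> R[i]) : measurable_fun unit_itv (re_part h) ->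
    measurable_fun unit_itv (im_part h) ->
    measurable_fun unit_itv (fun x => (ComplexField.Normc.normc (h x) ^+ 2)%:E).
  move=> mr mi; apply/measurable_EFinP.
  apply: (@eq_measurable_fun _ _ _ _ _ (fun x => re_part h x ^+ 2 + im_part h x ^+ 2)).
    by move=> x _; rewrite normc_sqr.
  by apply: measurable_funD; exact: measurable_funX.
apply: ae_eq_integral => //; [exact: measurable_itv|exact: mN|exact: mN|].
by apply: filterS fg => x H /H ->.
Qed.

(** * The symmetric bilinear form of D_alpha + beta *)

Section Operator.
Variables (a b : R -> R[i]) (M : R).
Hypothesis ra_meas : measurable_fun unit_itv (re_part a).
Hypothesis ia_meas : measurable_fun unit_itv (im_part a).
Hypothesis rb_meas : measurable_fun unit_itv (re_part b).
Hypothesis ib_meas : measurable_fun unit_itv (im_part b).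
Hypothesis a_bounded : forall x, 0 < x < 1 -> `|re_part a x| <= M /\ `|im_part a x| <= M.
Hypothesis b_bounded : forall x, 0 < x < 1 -> `|re_part b x| <= M /\ `|im_part b x| <= M.

Let T := D_op_add a b.

Lemma D_op_add_csq u f : T u f -> csq u /\ csq f.
Proof.
by move=> [/L2P fs [g [du [[/L2P us _ _] _] _] _]].
Qed.

(** The weak formulation, obtained from [weak_deriv_H10] with P = a u' and Q = -g. Letting v range
    over all of H^1_0 makes it possible to insert a second element of the operator domain, and the
    right-hand side is symmetric in the two. *)
Lemma D_op_add_weak u f : T u f -> exists2 du, csq du &
  H10 u du /\ forall v dv, H10 v dv ->
    cintegral (fun x => f x * v x) =
    cintegral (fun x => a x * du x * dv x) + cintegral (fun x => b x * u x * v x).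
Proof.
move=> Tuf; have [us fs] := D_op_add_csq Tuf.
case: Tuf => _ [g [du Hu [/L2P gs W]] fg].
have /L2P dus : L2 du by case: Hu => [[]].
exists du => //; split=> // v dv Hv.
have /L2P vs : L2 v by case: Hv => [[]].
have bus : csq (fun x => b x * u x) := csqMb rb_meas ib_meas b_bounded us.
have adus : csq (fun x => a x * du x) := csqMb ra_meas ia_meas a_bounded dus.
have gN : csq (fun x => - g x).
  by apply: eq_csq (csqB gs (csqD gs gs)) => x _; ring.
have -> := weak_deriv_H10 adus gN W Hv.
rewrite (ae_eq_cintegral (g := fun x => (g x + b x * u x) * v x)).
- rewrite (eq_cintegral (g := fun x => g x * v x + b x * u x * v x));
    last by move=> x _; rewrite mulrDl.
  rewrite cintegralD; [|exact: csq_cintegrableM|exact: csq_cintegrableM].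
  congr (_ + _); rewrite -cintegralN; last exact: csq_cintegrableM.
  by apply: eq_cintegral => x _; rewrite mulNr opprK.
- exact: csq_cintegrableM.
- by apply: csq_cintegrableM => //; exact: csqD.
- exact: ae_eq01M.
Qed.

Lemma D_op_add_symmetric u v f g : T u f -> T v g ->
  cintegral (fun x => f x * v x) = cintegral (fun x => g x * u x).
Proof.
move=> /D_op_add_weak[du _ [Hu wu]] /D_op_add_weak[dv _ [Hv wv]].
rewrite (wu _ _ Hv) (wv _ _ Hu); congr (_ + _);
  by apply: eq_cintegral => x _; ring.
Qed.

(** Duality: solve T w = conj(u - v). By symmetry the integral of |u - v|^2 equals int f w - int f w
    = 0. *)
Lemma onto_one_to_one : onto T -> one_to_one T.
Proof.
move=> oT u v f Tu Tv; have [us _] := D_op_add_csq Tu; have [vs _] := D_op_add_csq Tv.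
pose g x := (u x - v x)^*.
have ds := csqB us vs.
have gs : csq g.
  have [[mr ir] [mi ii]] := ds; split.
    by apply: eq_sqint (conj mr ir) => x _; rewrite /re_part /g; case: (_ - _).
  apply: eq_sqint (sqintZ (-1) (conj mi ii)) => x _.
  by rewrite mulN1r /im_part /g; case: (_ - _).
have [w Tw] := oT g ((L2P g).2 gs).
have E : cintegral (fun x => g x * (u x - v x)) = 0.
  rewrite (eq_cintegral (g := fun x => g x * u x - g x * v x));
    last by move=> x _; rewrite mulrBr.
  rewrite cintegralB; [|exact: csq_cintegrableM|exact: csq_cintegrableM].
  by rewrite -(D_op_add_symmetric Tu Tw) -(D_op_add_symmetric Tv Tw) subrr.
apply: ae_eq01_sqnorm => //.
have : complex.Re (cintegral (fun x => g x * (u x - v x))) = 0 by rewrite E.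
move=> <-; rewrite /sqnorm -RintegralD//; [|by case: ds => [[]]|by case: ds => _ []].
apply: eq_integral_on => x _; rewrite /re_part /im_part /g.
by case: (u x - v x) => p q /=; ring.
Qed.

Lemma solution_continuously_invertible (C : R) :
  (forall f, L2 f -> exists2 u, T u f & L2norm u <= C * L2norm f) ->
  continuously_invertible T.
Proof.
move=> S; have oT : onto T by move=> f /S[u Tu _]; exists u.
have inj := onto_one_to_one oT; split=> //.
exists C => u f Tu; have [us /L2P fs] := D_op_add_csq Tu.
have [v Tv vC] := S f fs; have [vs _] := D_op_add_csq Tv.
by rewrite (ae_eq01_L2norm us vs (inj _ _ _ Tu Tv)).
Qed.

End Operator.

End WeakDerivatives.

(** * Transition matrices *)

Section TransitionMatrix.
Context {R : realType}.
Implicit Types (x y h : R) (f g u du : R -> R[i]) (k tau z d e : R[i]).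

Lemma cis_derive_eq f g x d e : (forall y, f y = g y) -> d = e ->
  cis_derive f x d -> cis_derive g x e.
Proof. by move=> /funext -> ->. Qed.

Lemma cis_deriveD f g x d e : cis_derive f x d -> cis_derive g x e ->
  cis_derive (fun y => f y + g y) x (d + e).
Proof.
move=> [fr fi] [gr gi]; split.
  by apply: is_derive_fun_eq (is_derive_funD fr gr) => [y|]; rewrite /re_part partE.
by apply: is_derive_fun_eq (is_derive_funD fi gi) => [y|]; rewrite /im_part partE.
Qed.

Lemma cis_deriveM f g x d e : cis_derive f x d -> cis_derive g x e ->
  cis_derive (fun y => f y * g y) x (d * g x + f x * e).
Proof.
move=> [fr fi] [gr gi]; split.
  have := is_derive_funD (is_derive_funM fr gr)
            (is_derive_funZ (-1) (is_derive_funM fi gi)).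
  by apply: is_derive_fun_eq => [y|]; rewrite /re_part /im_part !partE; ring.
have := is_derive_funD (is_derive_funM fr gi) (is_derive_funM fi gr).
by apply: is_derive_fun_eq => [y|]; rewrite /re_part /im_part !partE; ring.
Qed.

Lemma cis_derive_cst k x : cis_derive (cst k) x 0.
Proof. by split; exact: is_derive_cst. Qed.

Lemma cis_deriveZ k f x d : cis_derive f x d ->
  cis_derive (fun y => k * f y) x (k * d).
Proof.
move=> /(cis_deriveM (cis_derive_cst k x)); apply: cis_derive_eq => //.
by rewrite mul0r add0r.
Qed.

Lemma cis_derive_shift f x (t : R) d : cis_derive f (x - t) d ->
  cis_derive (fun y => f (y - t)) x d.
Proof.
have S : is_derive x 1 (fun y : R => y - t) 1 by exact: is_derive_shift.
move=> [fr fi]; split.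
  have := @is_derive1_comp _ (re_part f) (fun y => y - t) x _ _ fr S.
  by apply: is_derive_fun_eq => //; rewrite mulr1.
have := @is_derive1_comp _ (im_part f) (fun y => y - t) x _ _ fi S.
by apply: is_derive_fun_eq => //; rewrite mulr1.
Qed.

Lemma cis_derive_continuous f g : (forall x, cis_derive f x (g x)) ->
  continuous (re_part f) /\ continuous (im_part f).
Proof.
by move=> D; split; apply: is_derive_continuous => x; case: (D x); eauto.
Qed.

Lemma cis_derive_cAC a b f g : (forall x, cis_derive f x (g x)) ->
  continuous (re_part g) -> continuous (im_part g) -> cAC a b f g.
Proof.
by move=> D gr gi; split; apply: continuous_derive_AC => // x; case: (D x).
Qed.

Lemma is_derive0_eq_end (F : R -> R) (a b : R) : a < b ->
  {within `[a, b], continuous F} -> (forall x, a < x < b -> is_derive x 1 F 0) ->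
  F b = F a.
Proof.
move=> ab cF dF; have dF' x : x \in `]a, b[ -> is_derive x 1 F (cst 0 x).
  by rewrite in_itv/= => /dF.
have [c _] := MVT ab dF' cF.
by rewrite /= mul0r => /eqP; rewrite subr_eq0 => /eqP.
Qed.

Lemma cis_derive0_eq_end f (a b : R) : a < b -> ccontinuous_within `[a, b] f ->
  (forall x, a < x < b -> cis_derive f x 0) -> f b = f a.
Proof.
move=> ab [cr ci] df; apply: complex_eq.
  by apply: (is_derive0_eq_end ab cr) => x /df[].
by apply: (is_derive0_eq_end ab ci) => x /df[].
Qed.

Lemma ccontinuous_withinM (A : set R) f g : ccontinuous_within A f ->
  ccontinuous_within A g -> ccontinuous_within A (fun x => f x * g x).
Proof.
move=> [fr fi] [gr gi]; split.
  rewrite (_ : re_part _ = (fun x => re_part f x * re_part g x -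
     im_part f x * im_part g x)); last by apply/funext => x; rewrite /re_part partE.
  by move=> x; apply: cvgB; apply: cvgM; [exact: fr|exact: gr|exact: fi|exact: gi].
rewrite (_ : im_part _ = (fun x => re_part f x * im_part g x +
     im_part f x * re_part g x)); last by apply/funext => x; rewrite /im_part partE.
by move=> x; apply: cvgD; apply: cvgM; [exact: fr|exact: gi|exact: fi|exact: gr].
Qed.

Lemma ccontinuous_withinB (A : set R) f g : ccontinuous_within A f ->
  ccontinuous_within A g -> ccontinuous_within A (fun x => f x - g x).
Proof.
move=> [fr fi] [gr gi]; split.
  rewrite (_ : re_part _ = (fun x => re_part f x - re_part g x));
    last by apply/funext => x; rewrite /re_part !partE.
  by move=> x; apply: cvgB; [exact: fr|exact: gr].
rewrite (_ : im_part _ = (fun x => im_part f x - im_part g x));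
  last by apply/funext => x; rewrite /im_part !partE.
by move=> x; apply: cvgB; [exact: fi|exact: gi].
Qed.

Lemma cis_derive_ccontinuous_within (A : set R) f g :
  (forall x, cis_derive f x (g x)) -> ccontinuous_within A f.
Proof.
by move=> /cis_derive_continuous[cr ci]; split; exact: continuous_subspaceT.
Qed.

(** This is x -> exp(z x) for real x, written through real functions because derivatives are taken
    on the two parts. *)
Definition cexp z x : R[i] :=
  (expR (complex.Re z * x) * cos (complex.Im z * x))
  +i* (expR (complex.Re z * x) * sin (complex.Im z * x)).

Lemma cis_derive_cexp z x : cis_derive (cexp z) x (z * cexp z x).
Proof.
have dl (t : R) : is_derive x 1 (fun y : R => t * y) t.
  by apply: is_derive_fun_eq (is_derive_funZ t (is_derive_id _ _)) => //; rewrite mulr1.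
have dE := is_derive1_comp (is_derive_expR (complex.Re z * x)) (dl (complex.Re z)).
have dC := is_derive1_comp (is_derive_cos (complex.Im z * x)) (dl (complex.Im z)).
have dS := is_derive1_comp (is_derive_sin (complex.Im z * x)) (dl (complex.Im z)).
split.
  apply: is_derive_fun_eq (is_derive_funM dE dC) => //.
  by rewrite /GRing.scale/= partE /=; ring.
apply: is_derive_fun_eq (is_derive_funM dE dS) => //.
by rewrite /GRing.scale/= partE /=; ring.
Qed.

Lemma cexp0 z : cexp z 0 = 1.
Proof. by rewrite /cexp !mulr0 expR0 cos0 sin0 mulr1 mulr0. Qed.

(* The analogues of cosh (sqrt tau x) and sinh (sqrt tau x) / sqrt tau. *)
Lemma fundamental_system tau : exists c s : R -> R[i],
  [/\ c 0 = 1, s 0 = 0, forall x, cis_derive c x (tau * s x) &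
      forall x, cis_derive s x (c x)].
Proof.
have [->|tau0] := eqVneq tau 0.
  exists (cst 1), (fun x => x +i* 0); split=> // x.
    by apply: cis_derive_eq (cis_derive_cst 1 x) => //; rewrite mul0r.
  by split; [exact: is_derive_id|exact: is_derive_cst].
pose m := sqrtc tau.
have mm : m * m = tau by rewrite -[m * m]expr2 sqr_sqrtc.
have m0 : m != 0 by rewrite sqrtc_eq0.
have two0 : (2 : R[i]) != 0 by rewrite pnatr_eq0.
exists (fun x => 2^-1 * (cexp m x + cexp (- m) x)).
exists (fun x => (2 * m)^-1 * (cexp m x + (- 1) * cexp (- m) x)); split.
- by rewrite !cexp0; field.
- by rewrite !cexp0; field; rewrite m0.
- move=> x; have := cis_deriveZ 2^-1
    (cis_deriveD (cis_derive_cexp m x) (cis_derive_cexp (- m) x)).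
  by apply: cis_derive_eq => //; rewrite -mm; field; rewrite m0.
- move=> x; have := cis_deriveZ (2 * m)^-1
    (cis_deriveD (cis_derive_cexp m x) (cis_deriveZ (-1) (cis_derive_cexp (- m) x))).
  by apply: cis_derive_eq => //; field; rewrite m0.
Qed.

Lemma mulmx22 (A : 'M[R[i]]_2) (a b : R[i]) :
  A *m col2 a b = col2 (A 0 0 * a + A 0 1 * b) (A 1 0 * a + A 1 1 * b).
Proof.
apply/matrixP => i j; rewrite !mxE !big_ord_recl big_ord0 !mxE /= addr0.
have -> : lift ord0 ord0 = 1 :> 'I_2 by apply/val_inj.
have [->|i0] := eqVneq i 0; first by [].
by have -> : i = 1 by apply/val_inj; case: i i0 => [[|[|]]].
Qed.

Lemma col2P (v : 'cV[R[i]]_2) : v = col2 (v 0 0) (v 1 0).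
Proof.
apply/matrixP => i j; rewrite !mxE ord1.
have [->|i0] := eqVneq i 0; first by [].
by have -> : i = 1 by apply/val_inj; case: i i0 => [[|[|]]].
Qed.

Lemma col2_inj (a b c d : R[i]) : col2 a b = col2 c d -> a = c /\ b = d.
Proof.
by move=> /matrixP H; split; [have := H 0 0|have := H 1 0]; rewrite !mxE.
Qed.

(** With c and s from [fundamental_system], the functions c u - s u', c u' - tau s u and c^2 - tau
    s^2 have derivative zero, hence equal u(0), u'(0) and 1 at h. The first two are a linear system
    for u(h) and u'(h) whose determinant is the third, so every solution is determined by its
    initial values. *)
Lemma is_transition_matrix_ex h tau : 0 < h ->
  exists A, is_transition_matrix h tau A.
Proof.
move=> h0; have [c [s [c0 s0 dc ds]]] := fundamental_system tau.
pose A : 'M[R[i]]_2 := \matrix_(i, j)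
  (if i == 0 then if j == 0 then c h else s h
   else if j == 0 then tau * s h else c h).
exists A => v u du [cu cdu D] <-.
have cc : ccontinuous_within `[0, h] c := cis_derive_ccontinuous_within _ dc.
have cs : ccontinuous_within `[0, h] s := cis_derive_ccontinuous_within _ ds.
have cts : ccontinuous_within `[0, h] (fun x => tau * s x).
  exact: (cis_derive_ccontinuous_within _ (fun x => cis_deriveZ tau (ds x))).
have W : c h * c h - tau * s h * s h = 1.
  pose w x := c x * c x - tau * s x * s x.
  have -> : c h * c h - tau * s h * s h = w h by [].
  have -> : w h = w 0.
    apply: cis_derive0_eq_end h0 _ _.
      by apply: ccontinuous_withinB; apply: ccontinuous_withinM.
    move=> x _; have := cis_deriveD (cis_deriveM (dc x) (dc x))
      (cis_deriveZ (-1) (cis_deriveM (cis_deriveZ tau (ds x)) (ds x))).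
    by apply: cis_derive_eq => [y|]; rewrite /w; ring.
  by rewrite /w c0 s0; ring.
have E1 : c h * u h - s h * du h = u 0.
  pose w x := c x * u x - s x * du x.
  have -> : u 0 = w 0 by rewrite /w c0 s0; ring.
  apply: (@cis_derive0_eq_end w _ _ h0).
    by apply: ccontinuous_withinB; apply: ccontinuous_withinM.
  move=> x /D[Du Ddu]; have := cis_deriveD (cis_deriveM (dc x) Du)
      (cis_deriveZ (-1) (cis_deriveM (ds x) Ddu)).
  by apply: cis_derive_eq => [y|]; rewrite /w; ring.
have E2 : c h * du h - tau * s h * u h = du 0.
  pose w x := c x * du x - tau * s x * u x.
  have -> : du 0 = w 0 by rewrite /w c0 s0; ring.
  apply: (@cis_derive0_eq_end w _ _ h0).
    by apply: ccontinuous_withinB; apply: ccontinuous_withinM.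
  move=> x /D[Du Ddu]; have := cis_deriveD (cis_deriveM (dc x) Ddu)
      (cis_deriveZ (-1) (cis_deriveM (cis_deriveZ tau (ds x)) Du)).
  by apply: cis_derive_eq => [y|]; rewrite /w; ring.
rewrite mulmx22 !mxE /=; congr col2; rewrite -E1 -E2.
  by rewrite -[RHS]mul1r -W; ring.
by rewrite -[RHS]mul1r -W; ring.
Qed.

(** Existence rules out the default value 0 of [xget]. *)
Lemma transition_matrixP h tau : 0 < h ->
  is_transition_matrix h tau (transition_matrix h tau).
Proof. by move=> h0; apply: xgetPex; exact: is_transition_matrix_ex. Qed.

Lemma tilde_mul (al : R[i]) (A : 'M[R[i]]_2) (a b : R[i]) :
  tilde al A *m col2 a b =
  col2 (A 0 0 * a + A 0 1 * (al^-1 * b)) (al * (A 1 0 * a + A 1 1 * (al^-1 * b))).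
Proof.
have D (t x y : R[i]) : diag_mx (row2 1 t) *m col2 x y = col2 x (t * y).
  by rewrite mulmx22 !mxE /=; congr col2; ring.
by rewrite /tilde -!mulmxA D mulmx22 D.
Qed.

(* Solutions of the first order system for (u, alpha u') with constant
   coefficients; its transition matrix is the matrix A~. *)
Lemma cell_solution (al be : R[i]) h (y : 'cV[R[i]]_2) : al != 0 -> 0 < h ->
  exists u p : R -> R[i],
    [/\ col2 (u 0) (p 0) = y,
        col2 (u h) (p h) = tilde al (transition_matrix h (be / al)) *m y,
        forall x, cis_derive u x (p x / al) & forall x, cis_derive p x (be * u x)].
Proof.
move=> al0 h0; set tau := be / al.
have [c [s [c0 s0 dc ds]]] := fundamental_system tau.
pose v0 := y 0 0; pose v1 := al^-1 * y 1 0.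
pose u x := v0 * c x + v1 * s x; pose du x := v0 * (tau * s x) + v1 * c x.
have Du x : cis_derive u x (du x).
  exact: cis_deriveD (cis_deriveZ _ (dc x)) (cis_deriveZ _ (ds x)).
have Ddu x : cis_derive du x (tau * u x).
  have := cis_deriveD (cis_deriveZ v0 (cis_deriveZ tau (ds x))) (cis_deriveZ v1 (dc x)).
  by apply: cis_derive_eq => //; rewrite /u; ring.
have ode : ode_solution h tau u du.
  split; [exact: cis_derive_ccontinuous_within Du|
          exact: cis_derive_ccontinuous_within Ddu|by []].
have T := transition_matrixP h0 ode erefl.
have u0 : u 0 = v0 by rewrite /u c0 s0; ring.
have du0 : du 0 = v1 by rewrite /du c0 s0; ring.
exists u, (fun x => al * du x); split.
- rewrite u0 du0 /v1 mulrA mulfV// mul1r; exact/esym/col2P.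
- rewrite [in RHS](col2P y) tilde_mul -/v0 -/v1.
  move: T; rewrite u0 du0 mulmx22 => /col2_inj[-> ->]; by [].
- by move=> x; apply: cis_derive_eq (Du x) => //; field.
- move=> x; apply: cis_derive_eq (cis_deriveZ al (Ddu x)) => //.
  by rewrite /tau; field.
Qed.

End TransitionMatrix.

(** * The first order system across the cells *)

Section PiecewiseConstant.
Context {R : realType} (r : nat).
Let h : R := r.+1%:R^-1.
Implicit Types (x : R) (c : nat -> R[i]).

Let h0 : 0 < h. Proof. by rewrite invr_gt0 ltr0n. Qed.

Let lasth : r.+1%:R * h = 1. Proof. by rewrite mulfV// pnatr_eq0. Qed.

Lemma piecewise_const_cell c n x : (n <= r)%N -> n%:R * h < x <= n.+1%:R * h ->
  piecewise_const r c x = c n.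
Proof.
move=> nr xn; have nr' : (n < r.+1)%N by [].
rewrite /piecewise_const (bigD1 (Ordinal nr'))//= big1 ?addr0.
  by rewrite indicE mem_set ?mulr1//= in_itv/=.
move=> j jn; rewrite indicE memNset ?mulr0//= in_itv/= => /andP[xj1 xj2].
have /andP[xn1 xn2] := xn.
have lt1 : (j%:R : R) < n.+1%:R by rewrite -(ltr_pM2r h0) (lt_le_trans xj1).
have lt2 : (n%:R : R) < j.+1%:R by rewrite -(ltr_pM2r h0) (lt_le_trans xn1).
move: lt1 lt2 jn; rewrite !ltr_nat !ltnS => l1 l2 /eqP; apply.
by apply/val_inj/eqP; rewrite /= eqn_leq l1 l2.
Qed.

Lemma cell_exists x : 0 < x <= 1 ->
  exists2 n, (n <= r)%N & n%:R * h < x <= n.+1%:R * h.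
Proof.
move=> /andP[x0 x1]; suff H n : (n <= r.+1)%N -> x <= n%:R * h ->
    exists2 m, (m <= r)%N & m%:R * h < x <= m.+1%:R * h.
  by apply: (H r.+1) => //; rewrite lasth.
elim: n => [_|n IH nr xn]; first by rewrite mul0r leNgt x0.
case: (leP x (n%:R * h)) => [|xn']; first by apply: IH; exact: ltnW.
by exists n => //; rewrite xn' xn.
Qed.

Lemma piecewise_const_exists c x : 0 < x <= 1 ->
  exists2 n, (n <= r)%N & piecewise_const r c x = c n.
Proof.
by move=> /cell_exists[n nr xn]; exists n => //; exact: piecewise_const_cell.
Qed.

Lemma piecewise_constV c x : 0 < x <= 1 ->
  (piecewise_const r c x)^-1 = piecewise_const r (fun j => (c j)^-1) x.
Proof.
by move=> /cell_exists[n nr xn]; rewrite !(piecewise_const_cell _ nr xn).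
Qed.

Lemma piecewise_const_csq c : csq (piecewise_const r c).
Proof.
suff H m : (m <= r.+1)%N -> sqint 0 (m%:R * h) (re_part (piecewise_const r c)) /\
    sqint 0 (m%:R * h) (im_part (piecewise_const r c)).
  by have := H r.+1 (leqnn _); rewrite lasth.
have mono n : n%:R * h <= n.+1%:R * h by rewrite ler_pM2r// ler_nat.
elim: m => [_|n IH nr].
  split; apply: (eq_sqint _ (sqint_cst _ _ 0)) => x /andP[x0];
    by rewrite mul0r => /(lt_trans x0); rewrite ltxx.
have [H1 H2] := IH (ltnW nr); split.
  apply: sqint_glue H1 _; apply: (eq_sqint _ (sqint_cst _ _ (complex.Re (c n)))).
  by move=> x /andP[x1 x2]; rewrite /re_part (@piecewise_const_cell _ n)// x1 ltW.
apply: sqint_glue H2 _; apply: (eq_sqint _ (sqint_cst _ _ (complex.Im (c n)))).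
by move=> x /andP[x1 x2]; rewrite /im_part (@piecewise_const_cell _ n)// x1 ltW.
Qed.

Lemma piecewise_const_bounded c : exists M : R, forall x, 0 < x < 1 ->
  `|re_part (piecewise_const r c) x| <= M /\
  `|im_part (piecewise_const r c) x| <= M.
Proof.
exists (\sum_(j < r.+1) (`|complex.Re (c j)| + `|complex.Im (c j)|)) => x.
move=> /andP[x0 x1].
have [|n nr E] := @piecewise_const_exists c x; first by rewrite x0 ltW.
have nr' : (n < r.+1)%N by [].
rewrite /re_part /im_part E (bigD1 (Ordinal nr'))//=.
have S : 0 <= \sum_(j < r.+1 | j != Ordinal nr')
    (`|complex.Re (c j)| + `|complex.Im (c j)|).
  by apply: sumr_ge0 => j _; rewrite addr_ge0.
by split; rewrite -addrA ?lerDl ?addr_ge0// addrCA lerDl addr_ge0.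
Qed.

Lemma csqM_piecewise c f : csq f -> csq (fun x => piecewise_const r c x * f x).
Proof.
have [[mr _] [mi _]] := piecewise_const_csq c.
have [M HM] := piecewise_const_bounded c.
exact: csqMb HM.
Qed.

Lemma csq_div_piecewise c f : csq f -> csq (fun x => f x / piecewise_const r c x).
Proof.
move=> /(csqM_piecewise (fun j => (c j)^-1)); apply: eq_csq => x /andP[x0 x1].
by rewrite mulrC piecewise_constV// x0 ltW.
Qed.

Variables (alpha beta : nat -> R[i]).
Hypothesis alpha_neq0 : forall j, (j <= r)%N -> alpha j != 0.

Let a := piecewise_const r alpha.
Let b := piecewise_const r beta.
Let At j := tilde (alpha j) (transition_matrix h (beta j / alpha j)).

Lemma piecewise_const_neq0 x : 0 < x <= 1 -> a x != 0.
Proof.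
move=> x01; have [n nr E] := piecewise_const_exists alpha x01.
by rewrite /a E alpha_neq0.
Qed.

(** Cell solutions start at 0 in their own coordinate and are moved to their cell here. The
    derivative [g] of [f] serves to make [f] continuous. *)
Lemma cAC_shift (s t : R) F f g (e : R) : (forall x, cis_derive F x (f x)) ->
  (forall x, cis_derive f x (g x)) ->
  cAC s t (fun x => F (x - e)) (fun x => f (x - e)).
Proof.
move=> D Dg; have D' x : cis_derive (fun x => F (x - e)) x (f (x - e)).
  exact: cis_derive_shift.
have Dg' x : cis_derive (fun x => f (x - e)) x (g (x - e)).
  exact: cis_derive_shift.
have [c1 c2] := cis_derive_continuous Dg'.
exact: cis_derive_cAC D' c1 c2.
Qed.

(** Induction on the number of cells: the state (u, p) at the end of one cell is the initial state
    on the next. The reversed index list puts the matrix of the newest cell on the left. *)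
Lemma homogeneous_solution_upto (y : 'cV[R[i]]_2) n : (n <= r.+1)%N ->
  exists u p : R -> R[i],
    [/\ cAC 0 (n%:R * h) u (fun x => p x / a x),
        cAC 0 (n%:R * h) p (fun x => b x * u x),
        col2 (u 0) (p 0) = y &
        col2 (u (n%:R * h)) (p (n%:R * h)) =
          (\prod_(j <- rev (index_iota 0 n)) At j) *m y].
Proof.
elim: n => [_|n IH nr].
  exists (cst (y 0 0)), (cst (y 1 0)).
  rewrite /index_iota /= big_nil mul1mx -col2P mul0r; split=> //.
    apply: cAC_eq (cAC_cst 0 0 (y 0 0)) => // x /andP[x0 x1].
    by move: (lt_trans x0 x1); rewrite ltxx.
  apply: cAC_eq (cAC_cst 0 0 (y 1 0)) => // x /andP[x0 x1].
  by move: (lt_trans x0 x1); rewrite ltxx.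
have [u [p [uA pA up0 upn]]] := IH (ltnW nr).
have nr' : (n <= r)%N by [].
set t := n%:R * h in uA pA upn *.
have t0 : 0 <= t by rewrite mulr_ge0// ltW.
have tS : n.+1%:R * h = t + h by rewrite -natr1 mulrDl mul1r.
have [v [q [vq0 vqh Dv Dq]]] :=
  cell_solution (beta n) (col2 (u t) (p t)) (alpha_neq0 nr') h0.
have [v0 q0] := col2_inj vq0.
(* Both branches agree at t because the cell solution starts from (u(t), p(t)), so each formula
   holds on a closed interval, as gluing requires. *)
pose U x := if x <= t then u x else v (x - t).
pose P x := if x <= t then p x else q (x - t).
have Ul x : x <= t -> U x = u x by rewrite /U => ->.
have Pl x : x <= t -> P x = p x by rewrite /P => ->.
have Ur x : t <= x -> U x = v (x - t).
  rewrite le_eqVlt => /predU1P[<-|tx]; last by rewrite /U leNgt tx.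
  by rewrite /U lexx subrr v0.
have Pr x : t <= x -> P x = q (x - t).
  rewrite le_eqVlt => /predU1P[<-|tx]; last by rewrite /P leNgt tx.
  by rewrite /P lexx subrr q0.
have cell x : t < x < t + h -> n%:R * h < x <= n.+1%:R * h.
  by rewrite tS => /andP[-> /ltW ->].
have Dvq x : cis_derive (fun x => q x / alpha n) x (beta n * v x / alpha n).
  have := cis_deriveZ (alpha n)^-1 (Dq x).
  by apply: cis_derive_eq => [z|]; rewrite mulrC.
exists U, P; rewrite tS; split.
- apply: (@cAC_glue _ _ t) => //.
    by apply: cAC_eq uA => x /andP[x0 xt]; rewrite ?Ul ?Pl// ltW.
  have := cAC_shift t (t + h) t Dv Dvq.
  apply: cAC_eq => x xt; first by rewrite Ur//; case/andP: xt.
  rewrite Pr; last by case/andP: xt => /ltW.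
  by rewrite /a (piecewise_const_cell _ nr' (cell _ xt)).
- apply: (@cAC_glue _ _ t) => //.
    by apply: cAC_eq pA => x /andP[x0 xt]; rewrite ?Ul ?Pl// ltW.
  have := cAC_shift t (t + h) t Dq (fun x => cis_deriveZ (beta n) (Dv x)).
  apply: cAC_eq => x xt; first by rewrite Pr//; case/andP: xt.
  rewrite Ur; last by case/andP: xt => /ltW.
  by rewrite /b (piecewise_const_cell _ nr' (cell _ xt)).
- by rewrite Ul// Pl.
- have th : t <= t + h by rewrite lerDl ltW.
  rewrite Ur// Pr// addrC addKr vqh upn.
  have -> : rev (index_iota 0 n.+1) = n :: rev (index_iota 0 n).
    by rewrite /index_iota !subn0 -[in LHS]addn1 iotaD rev_cat.
  by rewrite big_cons mulmxA.
Qed.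

Lemma homogeneous_solution (y : 'cV[R[i]]_2) : exists u p : R -> R[i],
    [/\ cAC 0 1 u (fun x => p x / a x), cAC 0 1 p (fun x => b x * u x),
        col2 (u 0) (p 0) = y &
        col2 (u 1) (p 1) = (\prod_(j <- rev (index_iota 0 r.+1)) At j) *m y].
Proof.
by have := homogeneous_solution_upto y (leqnn r.+1); rewrite lasth.
Qed.

(** The quotient p / a may jump at the grid points, so it is approximated cell by cell. Inside a
    cell it is a constant multiple of p, which is uniformly continuous because its density q is
    square integrable. *)
Lemma cAC_div_L2_approx p q : cAC 0 1 p q -> csq q -> forall e : R, 0 < e ->
  L2_approx 0 1 (re_part (fun x => p x / a x)) e /\
  L2_approx 0 1 (im_part (fun x => p x / a x)) e.
Proof.
move=> pA qs.
suff H m : (m < r.+1)%N -> forall e : R, 0 < e ->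
    L2_approx 0 (m.+1%:R * h) (re_part (fun x => p x / a x)) e /\
    L2_approx 0 (m.+1%:R * h) (im_part (fun x => p x / a x)) e.
  by move=> e e0; have := H r (leqnn _) e e0; rewrite lasth.
have nh0 n : 0 <= n%:R * h by rewrite mulr_ge0// ltW.
have mono n : n%:R * h < n.+1%:R * h by rewrite ltr_pM2r// ltr_nat.
have last n : (n <= r)%N -> n.+1%:R * h <= 1.
  by move=> nr; rewrite -[leRHS]lasth ler_pM2r// ler_nat.
have cell n : (n <= r)%N -> forall e : R, 0 < e ->
    L2_approx (n%:R * h) (n.+1%:R * h) (re_part (fun x => p x / a x)) e /\
    L2_approx (n%:R * h) (n.+1%:R * h) (im_part (fun x => p x / a x)) e.
  move=> nr e e0.
  have kA := cAC_S (nh0 n) (last n nr) (cAC_Z (alpha n)^-1 pA).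
  have E x : n%:R * h < x < n.+1%:R * h -> (alpha n)^-1 * p x = p x / a x.
    move=> /andP[x1 x2]; rewrite mulrC /a (@piecewise_const_cell _ n)// x1.
    exact: ltW.
  have ks : csq (fun x => (alpha n)^-1 * q x).
    have [qr qi] := qs; split.
      by apply: eq_sqint (sqintB (sqintZ (complex.Re (alpha n)^-1) qr)
        (sqintZ (complex.Im (alpha n)^-1) qi)) => x _; rewrite /re_part partE.
    by apply: eq_sqint (sqintD (sqintZ (complex.Re (alpha n)^-1) qi)
        (sqintZ (complex.Im (alpha n)^-1) qr)) => x _; rewrite /im_part partE.
  have [ksr ksi] := ks; have [kAr kAi] := kA.
  have lt := mono n.
  split.
    apply: (eq_L2_approx (w := re_part (fun x => (alpha n)^-1 * p x))).
      by move=> x /E; rewrite /re_part => ->.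
    apply: L2_approx_uc e0 => //; first exact: AC_measurable kAr.
    move=> s s0.
    have [dl dl0 D] := AC_uniform_continuity kAr (sqintS (nh0 n) (last n nr) ksr) s0.
    by exists dl => // x y /andP[/ltW x1 /ltW x2] /andP[/ltW y1 /ltW y2]; apply: D;
      apply/andP.
  apply: (eq_L2_approx (w := im_part (fun x => (alpha n)^-1 * p x))).
    by move=> x /E; rewrite /im_part => ->.
  apply: L2_approx_uc e0 => //; first exact: AC_measurable kAi.
  move=> s s0.
  have [dl dl0 D] := AC_uniform_continuity kAi (sqintS (nh0 n) (last n nr) ksi) s0.
  by exists dl => // x y /andP[/ltW x1 /ltW x2] /andP[/ltW y1 /ltW y2]; apply: D;
    apply/andP.
elim: m => [_ e e0|n IH nr e e0].
  by have := cell 0%N isT e e0; rewrite mul0r.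
(* Half of the tolerance is kept for the cell that is added. *)
have e20 : 0 < e / 2 by rewrite divr_gt0.
have [r1 i1] := IH (ltnW nr) _ e20; have [r2 i2] := cell n.+1 nr _ e20.
have lt := ltW (mono n.+1).
by split; rewrite [e]splitr; [exact: L2_approx_glue r1 r2|exact: L2_approx_glue i1 i2].
Qed.

End PiecewiseConstant.

(** * The boundary value problem *)

Section SquaredModulus.
Context {R : realType}.
Notation mu := (@lebesgue_measure R).
Implicit Types (z w : R[i]) (f g F G : R -> R[i]) (B C x : R).

Definition sqmod z : R := complex.Re z ^+ 2 + complex.Im z ^+ 2.

Lemma sqmod_ge0 z : 0 <= sqmod z.
Proof. by rewrite addr_ge0// sqr_ge0. Qed.

Lemma sqmodM z w : sqmod (z * w) = sqmod z * sqmod w.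
Proof. by rewrite /sqmod !partE; ring. Qed.

Lemma sqmodD z w : sqmod (z + w) <= 2 * sqmod z + 2 * sqmod w.
Proof.
rewrite /sqmod !partE; case: z w => [p q] [s t] /=.
have := sqr_ge0 (p - s); have := sqr_ge0 (q - t); rewrite !sqrrB !sqrrD; lra.
Qed.

Lemma sqmodB z w : sqmod (z - w) <= 2 * sqmod z + 2 * sqmod w.
Proof.
rewrite (_ : sqmod w = sqmod (- w)); first exact: sqmodD.
by rewrite /sqmod !partE !sqrrN.
Qed.

Lemma sqnormE f : csq f -> sqnorm f = \int[mu]_(x in `]0, 1[) sqmod (f x).
Proof. by move=> [[_ ir] [_ ii]]; rewrite /sqnorm -RintegralD. Qed.

Lemma csq_sqmod f : csq f -> integrable_on 0 1 (fun x => sqmod (f x)).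
Proof. by move=> [[_ ir] [_ ii]]; exact: integrable_onD. Qed.

Lemma sqnormM_le f g B : csq f -> csq (fun x => g x * f x) ->
  (forall x, 0 < x < 1 -> sqmod (g x) <= B) ->
  sqnorm (fun x => g x * f x) <= B * sqnorm f.
Proof.
move=> fs gfs gB; rewrite !sqnormE// -RintegralZl//; last exact: csq_sqmod.
apply: le_integral_on; [exact: csq_sqmod|exact/integrable_onZ/csq_sqmod|].
by move=> x /gB H; rewrite sqmodM ler_wpM2r// sqmod_ge0.
Qed.

Lemma sqnorm_le f C : csq f -> (forall x, 0 < x < 1 -> sqmod (f x) <= C) ->
  sqnorm f <= C.
Proof.
move=> fs fC; rewrite sqnormE// -[leRHS]mulr1 -[X in _ <= _ * X](subr0 1).
rewrite -(integral_on_cst _ ler01).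
apply: (@le_integral_on _ _ _ (fun x => sqmod (f x)) (cst C)) => //.
  exact: csq_sqmod.
exact: integrable_on_cst.
Qed.

Lemma cAC_bounded F f : cAC 0 1 F f ->
  exists B, forall x, 0 <= x <= 1 -> sqmod (F x) <= B.
Proof.
move=> [/AC_bounded[M1 H1] /AC_bounded[M2 H2]].
exists (M1 ^+ 2 + M2 ^+ 2) => x x01; apply: lerD.
  rewrite -real_normK ?num_real// lerXn2r ?nnegrE ?(H1 x)//.
  exact: le_trans (H1 _ x01).
rewrite -real_normK ?num_real// lerXn2r ?nnegrE ?(H2 x)//.
exact: le_trans (H2 _ x01).
Qed.

Lemma cAC_primitive f : cintegrable f -> exists2 F, cAC 0 1 F f & F 0 = 0.
Proof.
move=> [fr fi].
exists (fun x => (\int[mu]_(t in `]0, x[) re_part f t)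
              +i* (\int[mu]_(t in `]0, x[) im_part f t)).
  by split; split=> // x _; rewrite /re_part /im_part /=
     (integral_on_empty _ (lexx 0)) add0r.
by rewrite !(integral_on_empty _ (lexx 0)).
Qed.

(** Cauchy-Schwarz on (0, x) with x <= 1, applied to each part. It bounds the coefficient functions
    in the variation of constants by the L_2 norm of the right-hand side. *)
Lemma cAC_sqmod_le F f x : cAC 0 1 F f -> csq f -> F 0 = 0 -> 0 <= x <= 1 ->
  sqmod (F x) <= sqnorm f.
Proof.
move=> [Fr Fi] [fr fi] F0 /andP[x0 x1].
have H (G g : R -> R) : AC 0 1 G g -> sqint 0 1 g -> G 0 = 0 ->
    G x ^+ 2 <= \int[mu]_(x in `]0, 1[) (g x ^+ 2).
  move=> GA gs G0; rewrite -[G x]subr0 -[X in _ - X]G0.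
  rewrite (AC_incr GA)//; have gx := sqintS (lexx 0) x1 gs.
  apply: le_trans (sqr_integral_le x0 gx) _; rewrite subr0.
  rewrite (integral_on_split x0 x1); last by case: gs.
  have J1 := sqint_ge0 0 x g; have J2 := sqint_ge0 x 1 g.
  apply: le_trans (ler_wpM2r J1 x1) _.
  by rewrite mul1r lerDl.
by apply: lerD; [apply: H Fr fr _|apply: H Fi fi _]; rewrite /re_part /im_part F0.
Qed.

End SquaredModulus.

Section BoundaryValueProblem.
Context {R : realType} (r : nat) (alpha beta : nat -> R[i]).
Notation mu := (@lebesgue_measure R).
Hypothesis alpha_neq0 : forall j, (j <= r)%N -> alpha j != 0.
Implicit Types (x : R) (u p v q f : R -> R[i]).

Let a := piecewise_const r alpha.
Let b := piecewise_const r beta.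
Let a_neq0 x : 0 < x <= 1 -> a x != 0.
Proof. exact: piecewise_const_neq0. Qed.

(** Here p represents alpha u', so D_alpha u = -p' = f - b u. The boundary values and the
    approximation of p / a put u into H^1_0. *)
Lemma D_op_add_intro u p f : csq f -> cAC 0 1 u (fun x => p x / a x) ->
  cAC 0 1 p (fun x => b x * u x - f x) -> u 0 = 0 -> u 1 = 0 ->
  D_op_add a b u f.
Proof.
move=> fs uA pA u0 u1; split; first exact/L2P.
have us := cAC_csq uA; have ps := cAC_csq pA.
have bus : csq (fun x => b x * u x) by exact: csqM_piecewise.
have qs : csq (fun x => b x * u x - f x) by exact: csqB.
have gs : csq (fun x => f x - b x * u x) by exact: csqB.
exists (fun x => f x - b x * u x); last first.
  by apply: aeW => x _; rewrite subrK.
have H := @cAC_div_L2_approx _ r alpha _ _ pA qs.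
exists (fun x => p x / a x).
  apply: cAC_H10 => //; first exact: csq_div_piecewise.
    by move=> e /H[].
  by move=> e /H[].
split; first exact/L2P.
have -> : (fun x => - (f x - b x * u x)) = (fun x => b x * u x - f x).
  by apply/funext => x; rewrite opprB.
apply: cAC_weak_deriv pA _ => x /andP[x0 x1].
by rewrite mulrC divfK// a_neq0// x0 ltW.
Qed.

(* Variation of constants: the Wronskian u3 p1 - u1 p3 is the constant p1 0. *)
Lemma bounded_right_inverse u1 p1 u3 p3 :
  cAC 0 1 u1 (fun x => p1 x / a x) -> cAC 0 1 p1 (fun x => b x * u1 x) ->
  cAC 0 1 u3 (fun x => p3 x / a x) -> cAC 0 1 p3 (fun x => b x * u3 x) ->
  u1 0 = 0 -> u3 0 = 1 -> p1 0 != 0 -> u1 1 != 0 ->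
  exists C : R, forall f, L2 f ->
    exists2 u, D_op_add a b u f & L2norm u <= C * L2norm f.
Proof.
move=> u1A p1A u3A p3A u10 u30 w0 u11; set w := p1 0 in w0.
have W x : 0 <= x <= 1 -> u3 x * p1 x - u1 x * p3 x = w.
  move=> /andP[x0 x1].
  have WA := cAC_B (cAC_M u3A p1A) (cAC_M u1A p3A).
  have {}WA : cAC 0 1 (fun x => u3 x * p1 x - u1 x * p3 x) (cst 0).
    by apply: cAC_eq WA => // y _; rewrite /=; ring.
  have -> : w = u3 0 * p1 0 - u1 0 * p3 0 by rewrite u10 u30 mul1r mul0r subr0.
  have [[_ Hr] [_ Hi]] := WA.
  apply: complex_eq.
    have := Hr x; rewrite /re_part /= => ->; last by rewrite x0.
    by rewrite (integral_on_cst 0 x0) mul0r addr0.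
  have := Hi x; rewrite /im_part /= => ->; last by rewrite x0.
  by rewrite (integral_on_cst 0 x0) mul0r addr0.
have [B1 HB1] := cAC_bounded u1A; have [B3 HB3] := cAC_bounded u3A.
have l01 : 0 <= (0 : R) <= 1 by rewrite lexx ler01.
have B10 : 0 <= B1 := le_trans (sqmod_ge0 _) (HB1 0 l01).
have B30 : 0 <= B3 := le_trans (sqmod_ge0 _) (HB3 0 l01).
pose K := sqmod w^-1; have K0 : 0 <= K := sqmod_ge0 _.
pose U := sqmod (u1 1)^-1; have U0 : 0 <= U := sqmod_ge0 _.
(* With N the squared norm of f, [S] N will bound |k|^2 and [D] N will bound |u|^2; every sum or
   difference of two terms costs a factor 2. *)
pose S := U * (4 * (B1 * (B3 * K))).
pose D := 2 * (2 * (S * B1) + 2 * (B3 * (B1 * K))) + 2 * (B1 * (B3 * K)).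
exists (Num.sqrt D) => f /L2P fs.
have g1s : csq (fun x => w^-1 * u1 x * f x) := csqM_cAC (cAC_Z w^-1 u1A) fs.
have g3s : csq (fun x => w^-1 * u3 x * f x) := csqM_cAC (cAC_Z w^-1 u3A) fs.
have [F1 F1A F10] := cAC_primitive (csq_cintegrable g1s).
have [F3 F3A F30] := cAC_primitive (csq_cintegrable g3s).
(* In u' the terms coming from F1' and F3' cancel; in p' they leave -w^-1 (u3 p1 - u1 p3) f = -f. At
   0 the function u vanishes because u1 and F1 do, and k is chosen to make it vanish at 1; this is
   where u1(1) is inverted. *)
pose k := (u1 1)^-1 * (u1 1 * F3 1 - u3 1 * F1 1).
pose u x := k * u1 x + u3 x * F1 x - u1 x * F3 x.
pose p x := k * p1 x + p3 x * F1 x - p1 x * F3 x.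
have uA : cAC 0 1 u (fun x => p x / a x).
  have := cAC_B (cAC_D (cAC_Z k u1A) (cAC_M u3A F1A)) (cAC_M u1A F3A).
  by apply: cAC_eq => // x _; rewrite /p; ring.
have pA : cAC 0 1 p (fun x => b x * u x - f x).
  have := cAC_B (cAC_D (cAC_Z k p1A) (cAC_M p3A F1A)) (cAC_M p1A F3A).
  apply: cAC_eq => // x /andP[/ltW x0 /ltW x1].
  have Wx : w^-1 * (u3 x * p1 x - u1 x * p3 x) = 1 by rewrite W ?x0// mulVf.
  by rewrite -[f x in RHS]mul1r -Wx /u; ring.
have us := cAC_csq uA.
exists u.
  apply: D_op_add_intro fs uA pA _ _.
    by rewrite /u u10 F10; ring.
  by rewrite /u /k; field.
set N := sqnorm f; have N0 : 0 <= N := sqnorm_ge0 f.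
have F1b x : 0 <= x <= 1 -> sqmod (F1 x) <= B1 * K * N.
  move=> x01; apply: le_trans (cAC_sqmod_le F1A g1s F10 x01) _.
  apply: sqnormM_le => // y /andP[/ltW y0 /ltW y1]; rewrite sqmodM mulrC.
  by rewrite ler_wpM2r// HB1// y0.
have F3b x : 0 <= x <= 1 -> sqmod (F3 x) <= B3 * K * N.
  move=> x01; apply: le_trans (cAC_sqmod_le F3A g3s F30 x01) _.
  apply: sqnormM_le => // y /andP[/ltW y0 /ltW y1]; rewrite sqmodM mulrC.
  by rewrite ler_wpM2r// HB3// y0.
have prod (c d : R) z z' : 0 <= c -> sqmod z <= c -> sqmod z' <= d * N ->
    sqmod (z * z') <= c * d * N.
  move=> c0 zc zd; rewrite sqmodM -mulrA; apply: ler_pM => //; exact: sqmod_ge0.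
have l11 : 0 <= (1 : R) <= 1 by rewrite lexx ler01.
have kb : sqmod k <= S * N.
  rewrite /k sqmodM /S -mulrA; apply: ler_wpM2l => //.
  apply: le_trans (sqmodB _ _) _.
  have t1 := prod _ _ _ _ B10 (HB1 1 l11) (F3b 1 l11).
  have t2 := prod _ _ _ _ B30 (HB3 1 l11) (F1b 1 l11).
  apply: le_trans (lerD (ler_wpM2l (ler0n _ 2) t1) (ler_wpM2l (ler0n _ 2) t2)) _.
  by rewrite le_eqVlt; apply/orP; left; apply/eqP; ring.
have ub x : 0 < x < 1 -> sqmod (u x) <= D * N.
  move=> /andP[/ltW x0 /ltW x1]; have x01 : 0 <= x <= 1 by rewrite x0.
  have t1 : sqmod (k * u1 x) <= S * B1 * N.
    rewrite mulrC [S * B1]mulrC; apply: prod => //; exact: HB1.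
  have t2 := prod _ _ _ _ B30 (HB3 x x01) (F1b x x01).
  have t3 := prod _ _ _ _ B10 (HB1 x x01) (F3b x x01).
  have two0 : (0 : R) <= 2 by [].
  apply: le_trans (sqmodB _ _) _.
  apply: le_trans (lerD (ler_wpM2l two0 (le_trans (sqmodD _ _)
    (lerD (ler_wpM2l two0 t1) (ler_wpM2l two0 t2)))) (ler_wpM2l two0 t3)) _.
  by rewrite le_eqVlt; apply/orP; left; apply/eqP; rewrite /D; ring.
have D0 : 0 <= D.
  by rewrite /D /S;
    repeat first [assumption|exact: ler0n|apply: addr_ge0|apply: mulr_ge0].
rewrite !L2normE// -sqrtrM// ler_wsqrtr//.
exact: sqnorm_le.
Qed.

(** Equality almost everywhere is all that injectivity in L_2 provides. It suffices, since p1
    depends on u1 only through the integral of b u1; then u1' = p1(0) / a is integrated over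
    (0,1). *)
Lemma null_solution_endpoint u1 p1 :
  cAC 0 1 u1 (fun x => p1 x / a x) -> cAC 0 1 p1 (fun x => b x * u1 x) ->
  ae_eq01 u1 (cst 0) -> u1 1 - u1 0 = p1 0 * mean (fun x => (a x)^-1).
Proof.
move=> uA pA u0.
have p1E x : 0 < x < 1 -> p1 x = p1 0.
  move=> /andP[/ltW x0 /ltW x1].
  have H (g : R -> R) : integrable_on 0 1 g ->
      (\forall x \ae mu, unit_itv x -> g x = 0) ->
      \int[mu]_(t in `]0, x[) g t = 0.
    move=> gi g0; transitivity (\int[mu]_(t in `]0, x[) (cst 0 t)).
      congr fine; apply: ae_eq_integral => //.
        exact: measurable_int (integrable_onS (lexx 0) x1 gi).
        exact: measurable_int (integrable_on_cst 0 x 0).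
      move: g0; apply: filterS; first exact: (ae_filter_ringOfSetsType mu).
      move=> t H; rewrite /= in_itv/= => /andP[t0 tx].
      by rewrite H// /unit_itv/= in_itv/= t0 (lt_le_trans tx).
    by rewrite (integral_on_cst 0 x0) mul0r.
  have [[ri Hr] [ii Hi]] := pA; have x01 : 0 <= x <= 1 by rewrite x0.
  apply: complex_eq.
    have := Hr x x01; rewrite /re_part H ?addr0//.
    by apply: filterS u0 => t E /E ->; rewrite mulr0.
  have := Hi x x01; rewrite /im_part H ?addr0//.
  by apply: filterS u0 => t E /E ->; rewrite mulr0.
rewrite -(cAC_cintegral uA) /mean.
have ai : cintegrable (fun x => (a x)^-1).
  apply: csq_cintegrable.
  apply: eq_csq (piecewise_const_csq r (fun j => (alpha j)^-1)) => x /andP[x0 x1].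
  by rewrite -piecewise_constV// x0 ltW.
have [F FA _] := cAC_primitive ai.
rewrite (cAC_cintegral FA) mulrBr -(cAC_cintegral (cAC_Z (p1 0) FA)).
by apply: eq_cintegral => x /p1E ->.
Qed.

Lemma one_to_one_endpoint u1 p1 :
  cAC 0 1 u1 (fun x => p1 x / a x) -> cAC 0 1 p1 (fun x => b x * u1 x) ->
  u1 0 = 0 -> p1 0 != 0 -> mean (fun x => (a x)^-1) != 0 ->
  one_to_one (D_op_add a b) -> u1 1 != 0.
Proof.
move=> uA pA u10 p10 m0 inj; apply/eqP => u11.
have z : csq (cst (0 : R[i])) := cAC_csq (cAC_cst 0 1 0).
have T1 : D_op_add a b u1 (cst 0).
  apply: D_op_add_intro z uA _ u10 u11.
  by apply: cAC_eq pA => // x _; rewrite subr0.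
have T0 : D_op_add a b (cst 0) (cst 0).
  apply: (@D_op_add_intro (cst 0) (cst 0) (cst 0) z) => //.
    by apply: cAC_eq (cAC_cst 0 1 0) => // x _; rewrite /= mul0r.
  by apply: cAC_eq (cAC_cst 0 1 0) => // x _; rewrite /= mulr0 subr0.
have := null_solution_endpoint uA pA (inj _ _ _ T1 T0).
rewrite u10 u11 subr0 => /esym/eqP; rewrite mulf_eq0 (negbTE p10) (negbTE m0).
by [].
Qed.

End BoundaryValueProblem.

(** * The number in condition (iii) *)

Section EndpointCriterion.
Context {R : realType}.

Lemma matrix11_eq0 (M : 'M[R[i]]_1) : (M == 0) = (M 0 0 == 0).
Proof.
apply/eqP/eqP => [->|M0]; first by rewrite mxE.
by apply/matrixP => i j; rewrite !ord1 M0 mxE.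
Qed.

Lemma row2_mul (a b c d : R[i]) : (row2 a b *m col2 c d) 0 0 = a * c + b * d.
Proof. by rewrite !mxE !big_ord_recl big_ord0 !mxE /= addr0. Qed.

(** The column is the matrix of cell 0 applied to (0, alpha_0), where alpha_0^-1 cancels; the row is
    the first row of the matrix of cell r. As r >= 1 these are different factors, at the two ends of
    the full product. *)
Lemma endpoint_formula (r : nat) (alpha : nat -> R[i]) (A : nat -> 'M[R[i]]_2) :
  (1 <= r)%N -> alpha 0%N != 0 ->
  let At j := tilde (alpha j) (A j) in
  (row2 (A r 0 0) ((alpha r)^-1 * A r 0 1)
      *m (\prod_(j <- rev (index_iota 1 r)) At j)
      *m col2 (A 0%N 0 1) (alpha 0%N * A 0%N 1 1)) 0 0 =
  ((\prod_(j <- rev (index_iota 0 r.+1)) At j) *m col2 0 (alpha 0%N)) 0 0.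
Proof.
move=> r1 a0 At.
have -> : rev (index_iota 0 r.+1) = r :: rcons (rev (index_iota 1 r)) 0%N.
  have -> : index_iota 0 r.+1 = rcons (index_iota 0 r) r.
    by rewrite /index_iota !subn0 -[in LHS]addn1 iotaD cats1.
  rewrite rev_rcons; congr (_ :: _).
  by rewrite -rev_cons; congr rev; case: r r1 => // r _; rewrite /index_iota subn1 subn0.
rewrite big_cons big_rcons /= -(mulmxA (row2 _ _)) -(mulmxA (At r)).
set Q := \prod_(j <- _) _; rewrite -(mulmxA Q).
have -> : At 0%N *m col2 0 (alpha 0%N) = col2 (A 0%N 0 1) (alpha 0%N * A 0%N 1 1).
  by rewrite /At tilde_mul mulVf// !mulr0 !mulr1 !add0r.
move: (Q *m _) => y; rewrite [y]col2P row2_mul /At tilde_mul [RHS]mxE /=.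
by rewrite mulrA [A r 0 1 * _]mulrC.
Qed.

End EndpointCriterion.

Theorem theorem5p4 (R : realType) (r : nat) (alpha beta : nat -> R[i])
    (hr : (1 <= r)%N)
    (halpha : forall j : nat, (j <= r)%N -> alpha j != 0) :
  let h : R := r.+1%:R^-1 in
  let a : R -> R[i] := piecewise_const r alpha in
  let b : R -> R[i] := piecewise_const r beta in
  let A (j : nat) : 'M[R[i]]_2 := transition_matrix h (beta j / alpha j) in
  let At (j : nat) : 'M[R[i]]_2 := tilde (alpha j) (A j) in
  let i : Prop := continuously_invertible (D_op_add a b) in
  let ii : Prop := one_to_one (D_op_add a b) in
  (* the product is At (r-1) *m ... *m At 1, in decreasing order of indices *)
  let iii : Prop :=
    row2 (A r 0 0) ((alpha r)^-1 * A r 0 1)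
      *m (\prod_(j <- rev (index_iota 1 r)) At j)
      *m col2 (A 0%N 0 1) (alpha 0%N * A 0%N 1 1) != 0 in
  mean (fun x => (a x)^-1) != 0 ->
  (i <-> ii) /\ (ii <-> iii).
Proof.
move=> h a b A At i ii iii m0.
have a0 : alpha 0%N != 0 by exact: halpha.
(* The data (0, alpha_0) are those of [endpoint_formula]; the data (1, 0) of [u3] make the Wronskian
   equal to p1(0) = alpha_0, which is nonzero. *)
have [u1 [p1 [u1A p1A /col2_inj[u10 p10] e1]]] :=
  homogeneous_solution beta halpha (col2 0 (alpha 0%N)).
have [u3 [p3 [u3A p3A /col2_inj[u30 _] _]]] :=
  homogeneous_solution beta halpha (col2 1 0).
have iiiE : iii <-> u1 1 != 0.
  rewrite /iii matrix11_eq0 endpoint_formula//.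
  by rewrite -/h -/A -/At in e1; rewrite -e1 mxE /=.
have p10' : p1 0 != 0 by rewrite p10.
have i_ii : i -> ii by case.
have ii_iii : ii -> iii.
  by move=> inj; apply/iiiE; exact: (one_to_one_endpoint halpha u1A p1A u10 p10' m0 inj).
have iii_i : iii -> i.
  move=> /iiiE u11.
  have [C HC] := bounded_right_inverse halpha u1A p1A u3A p3A u10 u30 p10' u11.
  have [Ma Ha] := piecewise_const_bounded r alpha.
  have [Mb Hb] := piecewise_const_bounded r beta.
  have [[mar _] [mai _]] := piecewise_const_csq r alpha.
  have [[mbr _] [mbi _]] := piecewise_const_csq r beta.
  apply: (@solution_continuously_invertible _ a b (Num.max Ma Mb)
    mar mai mbr mbi _ _ C HC).
    by move=> x /Ha[? ?]; rewrite !le_max; split; apply/orP; left.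
  by move=> x /Hb[? ?]; rewrite !le_max; split; apply/orP; right.
by split; split; auto.
Qed.
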